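(* Let $K\ge 1$, $f_\star\in\Delta_K$, and for each $n$ let $f_n$ be a random vector with $n f_n\sim\operatorname{Multinomial}(n;f_\star)$. Let $l=(l_1,\dots,l_K)^\top\in\mathbb{R}_+^K$, $\varepsilon\ge 0$, $C\in\mathbb{R}_+^{K\times K}$ and $D\in\{0,1\}^{K\times K}$, where $C$ and $D$ have zero diagonals, and let $\psi$ be the associated audit value function. Define $$\Lambda=\operatorname*{argmax}_{\nu\le 0,\ \mu\le 0,\ \lambda\in\mathbb{R}^K}\Big\{\varepsilon\nu+f_\star^\top\lambda:\ \nu C+\mu D+\lambda\mathbf{1}_K^\top\le-\mathbf{1}_K l^\top\ \text{entrywise}\Big\}.$$ Then, as $n\to\infty$, $$\sqrt{n}\,\{\psi(f_n)-\psi(f_\star)\}\ \xrightarrow{d}\ \inf\{(\lambda+l)^\top Z:\ (\nu,\mu,\lambda)\in\Lambda\},$$ where $Z\sim\mathcal{N}(\mathbf{0}_K,\Sigma(f_\star))$.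
   Context: $\Delta_K=\{x\in\mathbb{R}_+^K:\mathbf{1}_K^\top x=1\}$ is the probability simplex; $\mathbf{1}_K$ is the all-ones vector; $\langle A,B\rangle=\sum_{i,j}A_{ij}B_{ij}$. $\Sigma(p)$ is the multinomial covariance matrix: $\Sigma(p)_{ii}=p_i(1-p_i)$ and $\Sigma(p)_{ij}=-p_ip_j$ for $i\ne j$. The audit value function $\psi:\Delta_K\to\mathbb{R}_+$ associated with $(l,\varepsilon,C,D)$ is $$\psi(f)=\max_{\Pi\in\mathbb{R}_+^{K\times K}}\ l^\top(\Pi^\top\mathbf{1}_K-f)\quad\text{subject to}\quad\langle C,\Pi\rangle\le\varepsilon,\ \ \langle D,\Pi\rangle=0,\ \ \Pi\mathbf{1}_K=f.$$ Here $C$ is a matrix of transportation costs on a finite sample space $\{z_1,\dots,z_K\}$ and $D_{ij}=1$ means that moving mass from $z_i$ to $z_j$ is forbidden. Moving mass from a point to itself is free and allowed, i.e. $C_{kk}=D_{kk}=0$ for all $k$, so the problem is feasible for every $f\in\Delta_K$. *)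

(* Defs.v *)
From HB Require Import structures.
From mathcomp Require Import all_boot all_order all_algebra.
From mathcomp Require Import all_classical all_reals all_analysis.
From mathcomp Require Import measurable_realfun.
Import Order.TTheory GRing.Theory Num.Theory.
Import numFieldNormedType.Exports.

Set Implicit Arguments.
Unset Strict Implicit.
Unset Printing Implicit Defensive.

Local Open Scope classical_set_scope.
Local Open Scope ring_scope.

Section LinearAlgebra.
Context {R : realType} {K : nat}.

Definition dotv (u v : 'cV[R]_K) : R := \sum_k u k 0 * v k 0.

Definition frob (A B : 'M[R]_K) : R := \sum_i \sum_j A i j * B i j.

Definition ones : 'cV[R]_K := const_mx 1.

Definition lemx (A B : 'M[R]_K) : Prop := forall i j, A i j <= B i j.

Definition simplex : set 'cV[R]_K :=
  [set p : 'cV[R]_K | (forall k, 0 <= p k 0) /\ dotv ones p = 1].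

Definition multinomial_cov (p : 'cV[R]_K) : 'M[R]_K :=
  \matrix_(i, j) if i == j then p i 0 * (1 - p i 0) else - (p i 0 * p j 0).

End LinearAlgebra.

Section Audit.
Context {R : realType} {K : nat}.
Variables (l : 'cV[R]_K) (eps : R) (C D : 'M[R]_K).

Definition transport_plans (f : 'cV[R]_K) : set 'M[R]_K :=
  [set Pi : 'M[R]_K | [/\ lemx 0 Pi, frob C Pi <= eps, frob D Pi = 0
              & Pi *m ones = f]].

(* For [f] in the simplex the feasible set is nonempty and compact, so this
   supremum is the maximum; outside the nonnegative orthant the feasible set is
   empty and the value is the junk value [sup set0 = 0]. *)
Definition audit_value (f : 'cV[R]_K) : R :=
  sup [set dotv l (Pi^T *m ones - f) | Pi in transport_plans f].

Definition dual_feasible : set (R * R * 'cV[R]_K) :=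
  [set t : R * R * 'cV[R]_K | let: (nu, mu, lam) := t in
    [/\ nu <= 0, mu <= 0
      & lemx (nu *: C + mu *: D + lam *m ones^T) (- (ones *m l^T))]].

Definition dual_objective (f : 'cV[R]_K) (t : R * R * 'cV[R]_K) : R :=
  let: (nu, mu, lam) := t in eps * nu + dotv f lam.

Definition dual_argmax (f : 'cV[R]_K) : set (R * R * 'cV[R]_K) :=
  [set t | dual_feasible t /\
    forall t', dual_feasible t' -> dual_objective f t' <= dual_objective f t].

End Audit.

Section Probability.
Context {R : realType} {K : nat}.

(* Column vectors carry no sigma-algebra in the library; measurability for the
   Borel sigma-algebra of R^K is measurability of every coordinate. *)
Definition random_vector d (T : measurableType d) (X : T -> 'cV[R]_K) : Prop :=
  forall k, measurable_fun setT (fun w => X w k 0).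

Definition multinomial_law d (T : measurableType d) (P : probability T R)
    (n : nat) (p : 'cV[R]_K) (X : T -> 'cV[R]_K) : Prop :=
  random_vector X /\
  forall c : {ffun 'I_K -> nat}, (\sum_k c k)%N = n ->
    P [set w | forall k, X w k 0 = (c k)%:R] =
    (n`!%:R / (\prod_k (c k)`!)%:R * \prod_k p k 0 ^+ c k)%:E.

(* The normal law on the line with mean [m] and variance [v].  The case [v = 0]
   is separate because the library's [normal_prob m 0] is the uniform law on
   [0, 1] instead of the point mass at [m]. *)
Definition normal_law (m v : R) (A : set R) : \bar R :=
  if v == 0 then \d_m A else normal_prob m (Num.sqrt v) A.

(* Multivariate normal law, possibly degenerate: every linear form a^T Z is
   univariate normal with mean a^T m and variance a^T S a. *)
Definition normal_vector d (T : measurableType d) (P : probability T R)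
    (m : 'cV[R]_K) (S : 'M[R]_K) (Z : T -> 'cV[R]_K) : Prop :=
  random_vector Z /\
  forall (a : 'cV[R]_K) (A : set R), measurable A ->
    P [set w | A (dotv a (Z w))] =
    normal_law (dotv a m) (dotv a (S *m a)) A.

End Probability.

(* Convergence in distribution of real random variables, each on its own
   probability space.  The limit is given as an extended-real function, which
   has to be measurable and almost surely finite. *)
Definition cvg_in_distribution {R : realType}
    (d : nat -> measure_display) (T : forall n, measurableType (d n))
    (P : forall n, probability (T n) R) (X : forall n, T n -> R)
    d' (T' : measurableType d') (Q : probability T' R) (W : T' -> \bar R)
    : Prop :=
  [/\ forall n, measurable_fun setT (X n),
      measurable_fun setT W,
      {ae Q, forall w, W w \is a fin_num}
    & forall g : R -> R, continuous g -> bounded_fun g ->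
        (fun n => 'E_(P n)[g \o X n])%E @ \oo --> 'E_Q[g \o (fine \o W)]%E].

(* Main.v *)
(* The audit problem is a linear program, so by Weyl's theorem its value is, on
   the whole nonnegative orthant, the minimum of finitely many affine functions
   of [f] indexed by dual-feasible points.  Near [fstar] only the indices optimal
   at [fstar] matter; hence [psi fn - psi fstar = phi (fn - fstar)] with [phi] a
   positively homogeneous Lipschitz function, and [phi (- z)] is the infimum of
   [(lam + l)^T z] over the dual optima.  What remains is the multinomial central
   limit theorem (the sign is absorbed by the symmetry of the normal law):
   expectations of [cos (a^T x + b)] under the normalised counts are computed step
   by step along a random walk, and trigonometric polynomials, obtained from
   Bernstein polynomials in [sin (beta x_k)], approximate continuous functions on
   cubes while keeping their bound on the whole space. *)
Require Import Defs.
From HB Require Import structures.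
From mathcomp Require Import all_boot all_order all_algebra.
From mathcomp Require Import all_classical all_reals all_analysis.
From mathcomp Require Import measurable_realfun.
From mathcomp Require Import ring lra.
Import Order.TTheory GRing.Theory Num.Theory.
Import numFieldNormedType.Exports.

Set Implicit Arguments.
Unset Strict Implicit.
Unset Printing Implicit Defensive.

Local Open Scope classical_set_scope.
Local Open Scope ring_scope.

(** * Weyl's theorem *)

(** Duality at a single [f] would not be enough: the local formula for the value needs one finite
    list of dual points that serves every [f] at once. It comes from the fact that cost, forbidden
    mass, gain and marginal of a plan, with slacks, range over a finitely generated cone whose
    defining inequalities do not depend on [f]. The function [phi] is a minimum over the optimal
    members of this list, while the theorem takes an infimum over the whole dual face, which may be
    unbounded. The two agree in directions that vanish wherever [fstar] does, and the normal limit
    lies there almost surely because its variance in those coordinates is zero. The limit theorem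
    stays real-valued: a free phase inside the cosine replaces complex characteristic functions. The
    approximants keep the bound of the test function everywhere, so the region off a cube is
    controlled by second moments alone, without a tightness argument. The count vectors live on
    unrelated probability spaces; only their laws enter, as finite recursions. *)

Definition ffdot {R : realFieldType} {I : finType} (u v : {ffun I -> R}) : R :=
  \sum_i u i * v i.

Section Weyl.
Context {R : realFieldType} {I : finType}.
Implicit Types u v g c : {ffun I -> R}.

Lemma ffdotBr g u v : ffdot g (u - v) = ffdot g u - ffdot g v.
Proof.
by rewrite /ffdot -sumrB; apply: eq_bigr => i _; rewrite !ffunE mulrBr.
Qed.

Lemma ffdotZr g (t : R) v : ffdot g (t *: v) = t * ffdot g v.
Proof.
by rewrite /ffdot mulr_sumr; apply: eq_bigr => i _; rewrite !ffunE mulrCA.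
Qed.

Lemma ffdotBl u v g : ffdot (u - v) g = ffdot u g - ffdot v g.
Proof.
by rewrite /ffdot -sumrB; apply: eq_bigr => i _; rewrite !ffunE mulrBl.
Qed.

Lemma ffdotZl (t : R) v g : ffdot (t *: v) g = t * ffdot v g.
Proof.
by rewrite /ffdot mulr_sumr; apply: eq_bigr => i _; rewrite !ffunE mulrA.
Qed.

Lemma seq_max0 (s : seq R) :
  exists2 t, 0 <= t & (forall x, x \in s -> x <= t) /\ (t = 0 \/ t \in s).
Proof.
elim: s => [|a s [t t0 [ht tt]]]; first by exists 0 => //; split => //; left.
have [at_|ta] := leP a t.
  exists t => //; split.
    by move=> x; rewrite inE => /orP[/eqP->|/ht].
  by case: tt => [->|ts]; [left|right; rewrite inE ts orbT].
exists a; first exact: le_trans (ltW ta).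
split; last by right; rewrite mem_head.
move=> x; rewrite inE => /orP[/eqP-> //|/ht /le_trans]; apply; exact: ltW.
Qed.

(* Fourier-Motzkin elimination of the scalar [t]. *)
Lemma fourier_motzkin (G : seq {ffun I -> R}) (a : {ffun I -> R}) :
  exists G' : seq {ffun I -> R}, forall c,
    (exists2 t, 0 <= t & forall g, g \in G -> 0 <= ffdot g (c - t *: a)) <->
    (forall g, g \in G' -> 0 <= ffdot g c).
Proof.
exists ([seq g <- G | 0 <= ffdot g a] ++
  [seq ffdot g a *: h - ffdot h a *: g |
     g <- [seq g <- G | 0 < ffdot g a], h <- [seq h <- G | ffdot h a < 0]]).
move=> c; split.
  move=> [t t0 ht] g; rewrite mem_cat => /orP[|/allpairsP[[g1 h] /=]].
    rewrite mem_filter => /andP[ga gG].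
    have := ht _ gG; rewrite ffdotBr ffdotZr subr_ge0; apply: le_trans.
    exact: mulr_ge0.
  rewrite !mem_filter => -[/andP[g1a g1G] /andP[ha hG] ->].
  have := ht _ g1G; have := ht _ hG.
  rewrite ffdotBl !ffdotZl !ffdotBr !ffdotZr => h1 h2.
  have := mulr_ge0 (ltW g1a) h1.
  have : 0 <= - ffdot h a by rewrite oppr_ge0 ltW.
  move=> /mulr_ge0 /(_ h2); lra.
move=> H.
(* The least candidate: the maximum of 0 and the lower bounds on [t] imposed by the [h] with
   [ffdot h a < 0]. The retained [g] and the mixed combinations say exactly that it stays below
   every upper bound. *)
have [t t0 [tub tin]] := seq_max0
  [seq ffdot h c / ffdot h a | h <- [seq h <- G | ffdot h a < 0]].
exists t => // g gG; rewrite ffdotBr ffdotZr subr_ge0.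
have [ga|ga] := ltP (ffdot g a) 0.
  have : ffdot g c / ffdot g a <= t.
    by apply: tub; apply/map_f; rewrite mem_filter ga.
  by rewrite ler_ndivrMr.
case: tin => [->|/mapP[h]].
  by rewrite mul0r; apply: H; rewrite mem_cat mem_filter ga gG.
rewrite mem_filter => /andP[ha hG] ->.
move: ga; rewrite le_eqVlt => /predU1P[ga|ga].
  by rewrite -ga mulr0; apply: H; rewrite mem_cat mem_filter -ga lexx gG.
have : 0 <= ffdot (ffdot g a *: h - ffdot h a *: g) c.
  apply: H; rewrite mem_cat; apply/orP; right; apply/allpairsP.
  by exists (g, h); rewrite /= !mem_filter ga ha gG hG.
rewrite ffdotBl !ffdotZl subr_ge0 => h1.
by rewrite mulrAC ler_ndivrMr// mulrC (mulrC (ffdot h c)).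
Qed.

(** Induction on the generators: [c] is in the cone of [j :: r] iff [c - t *: a j] is in the cone of
    [r] for some [t >= 0], and elimination of [t] preserves finiteness of the list. The empty cone
    [{0}] is cut out by the coordinates with both signs. *)
Lemma weyl_seq (J : eqType) (a : J -> {ffun I -> R}) (r : seq J) : uniq r ->
  exists G : seq {ffun I -> R}, forall c,
    (exists2 x : J -> R, forall j, 0 <= x j & c = \sum_(j <- r) x j *: a j) <->
    (forall g, g \in G -> 0 <= ffdot g c).
Proof.
elim: r => [_|j r IH /= /andP[jr /IH[G hG]]].
  exists ([seq [ffun k => (k == i)%:R] | i <- enum I] ++
          [seq - [ffun k => (k == i)%:R] | i <- enum I]) => c.
  have dE i : ffdot [ffun k => (k == i)%:R] c = c i.
    rewrite /ffdot (bigD1 i)//= ffunE eqxx mul1r big1 ?addr0// => k ki.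
    by rewrite ffunE (negbTE ki) mul0r.
  have dNE i : ffdot (- [ffun k => (k == i)%:R]) c = - c i.
    rewrite -dE /ffdot -sumrN; apply: eq_bigr => k _.
    by rewrite !ffunE mulNr.
  split.
    move=> [x _ ->] g _; rewrite big_nil /ffdot big1// => i _.
    by rewrite !ffunE mulr0.
  move=> H; exists (fun=> 0) => //; rewrite big_nil.
  apply/ffunP => i; rewrite ffunE; apply/eqP; rewrite eq_le.
  have -> : 0 <= c i.
    rewrite -dE; apply: H; rewrite mem_cat; apply/orP; left.
    by apply: (@map_f _ _ (fun i0 : I => [ffun k => (k == i0)%:R])); rewrite mem_enum.
  rewrite andbT -oppr_ge0 -dNE; apply: H; rewrite mem_cat; apply/orP; right.
  by apply: (@map_f _ _ (fun i0 : I => - [ffun k => (k == i0)%:R])); rewrite mem_enum.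
have [G' hG'] := fourier_motzkin G (a j).
exists G' => c; rewrite -hG'; split.
  move=> [x x0 ->]; exists (x j) => //; apply/hG; exists x => //.
  by rewrite big_cons addrC addKr.
move=> [t t0 /hG[x x0 hx]].
exists (fun k => if k == j then t else x k) => [k|]; first by case: ifP.
rewrite big_cons eqxx -[LHS](subrK (t *: a j)) hx addrC; congr (_ + _).
apply: eq_big_seq => k kr; case: eqP => // kj.
by rewrite -kj kr in jr.
Qed.

Lemma weyl (J : finType) (a : J -> {ffun I -> R}) :
  exists G : seq {ffun I -> R}, forall c,
    (exists2 x : J -> R, forall j, 0 <= x j & c = \sum_j x j *: a j) <->
    (forall g, g \in G -> 0 <= ffdot g c).
Proof.
have [G hG] := weyl_seq a (index_enum_uniq J).
by exists G.
Qed.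

End Weyl.

(** * Linear programming duality for the audit value *)

Section Dotv.
Context {R : realType} {K : nat}.
Implicit Types u v w : 'cV[R]_K.

Lemma dotvC u v : dotv u v = dotv v u.
Proof. by apply: eq_bigr => k _; rewrite mulrC. Qed.

Lemma dotvDl u v w : dotv (u + v) w = dotv u w + dotv v w.
Proof. by rewrite -big_split; apply: eq_bigr => k _; rewrite !mxE mulrDl. Qed.

Lemma dotvZl (a : R) u v : dotv (a *: u) v = a * dotv u v.
Proof. by rewrite /dotv mulr_sumr; apply: eq_bigr => k _; rewrite !mxE mulrA. Qed.

Lemma dotvDr u v w : dotv u (v + w) = dotv u v + dotv u w.
Proof. by rewrite dotvC dotvDl !(dotvC _ u). Qed.

Lemma dotvZr (a : R) u v : dotv u (a *: v) = a * dotv u v.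
Proof. by rewrite dotvC dotvZl (dotvC v). Qed.

Lemma dotvNl u v : dotv (- u) v = - dotv u v.
Proof. by rewrite -scaleN1r dotvZl mulN1r. Qed.

Lemma dotvNr u v : dotv u (- v) = - dotv u v.
Proof. by rewrite dotvC dotvNl (dotvC v). Qed.

Lemma dotvBl u v w : dotv (u - v) w = dotv u w - dotv v w.
Proof. by rewrite dotvDl dotvNl. Qed.

Lemma dotvBr u v w : dotv u (v - w) = dotv u v - dotv u w.
Proof. by rewrite dotvDr dotvNr. Qed.

Lemma dotv0l u : dotv 0 u = 0.
Proof. by rewrite -(scale0r (0 : 'cV[R]_K)) dotvZl mul0r. Qed.

Lemma dotv_delta u k : dotv u (delta_mx k 0) = u k 0.
Proof.
rewrite /dotv (bigD1 k)//= !mxE !eqxx mulr1 big1 ?addr0// => i ik.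
by rewrite !mxE (negbTE ik) mulr0.
Qed.

End Dotv.

Section AuditDuality.
Context {R : realType} {K : nat}.
Variables (l : 'cV[R]_K) (eps : R) (C D : 'M[R]_K).
Hypothesis hl : forall k, 0 <= l k 0.
Hypothesis heps : 0 <= eps.
Hypothesis hC0 : forall k, C k k = 0.
Hypothesis hD : forall i j, D i j = 0 \/ D i j = 1.
Hypothesis hD0 : forall k, D k k = 0.

Local Notation nonneg f := (forall k, 0 <= (f : 'cV[R]_K) k 0).

(** The upper bound on the audit value certified by [t]: affine in [f] with slope [- (t.2 + l)], and
    minimal where [dual_objective] is maximal. *)
Definition dual_value (t : R * R * 'cV[R]_K) (f : 'cV[R]_K) : R :=
  - (eps * t.1.1) - dotv (t.2 + l) f.

Lemma gainE (Pi : 'M[R]_K) :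
  dotv l (Pi^T *m ones) = \sum_i \sum_j l j 0 * Pi i j.
Proof.
rewrite exchange_big; apply: eq_bigr => j _; rewrite mxE mulr_sumr.
by apply: eq_bigr => i _; rewrite !mxE mulr1.
Qed.

Lemma plan_rowE (Pi : 'M[R]_K) f i : Pi *m ones = f -> f i 0 = \sum_j Pi i j.
Proof. by move=> <-; rewrite mxE; apply: eq_bigr => j _; rewrite mxE mulr1. Qed.

Lemma dual_feasibleP (t : R * R * 'cV[R]_K) :
  dual_feasible l C D t <-> [/\ t.1.1 <= 0, t.1.2 <= 0 &
    forall i j, t.1.1 * C i j + t.1.2 * D i j + t.2 i 0 <= - l j 0].
Proof.
case: t => -[nu mu] lam; rewrite /dual_feasible /lemx /=.
have E i j : (nu *: C + mu *: D + lam *m ones^T) i j =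
   nu * C i j + mu * D i j + lam i 0.
  by rewrite !mxE big_ord1 !mxE mulr1.
have E' i j : (- ((ones : 'cV[R]_K) *m l^T)) i j = - l j 0.
  by rewrite !mxE big_ord1 !mxE mul1r.
split=> -[nu0 mu0 H]; split => // i j.
  by have := H i j; rewrite E E'.
by rewrite E E'; exact: H.
Qed.

(** The dual constraints are summed with weights [Pi i j >= 0]; [frob D Pi = 0] removes the
    multiplier [t.1.2], and [t.1.1 <= 0] converts the cost bound. *)
Lemma weak_duality t f (Pi : 'M[R]_K) : dual_feasible l C D t ->
  transport_plans eps C D f Pi -> dotv l (Pi^T *m ones - f) <= dual_value t f.
Proof.
move=> /dual_feasibleP[nu0 mu0 H] [Pi0 hCP hDP hf].
rewrite dotvBr /dual_value dotvDl opprD addrA lerBlDr subrK.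
have : \sum_i \sum_j (t.1.1 * C i j + t.1.2 * D i j + t.2 i 0 + l j 0) * Pi i j <= 0.
  apply: sumr_le0 => i _; apply: sumr_le0 => j _; apply: mulr_le0_ge0.
    by have := H i j; lra.
  by have := Pi0 i j; rewrite mxE.
have -> : \sum_i \sum_j (t.1.1 * C i j + t.1.2 * D i j + t.2 i 0 + l j 0) * Pi i j =
   t.1.1 * frob C Pi + t.1.2 * frob D Pi + dotv t.2 f + dotv l (Pi^T *m ones).
  rewrite gainE /dotv /frob !mulr_sumr -!big_split; apply: eq_bigr => i _ /=.
  rewrite (plan_rowE i hf) !mulr_sumr -!big_split; apply: eq_bigr => j _ /=.
  by rewrite !mulrDl !mulrA.
rewrite hDP mulr0 addr0.
have := ler_wnM2l nu0 hCP; rewrite (mulrC _ eps); lra.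
Qed.

(** The coordinates stand for cost, forbidden mass, gain and row marginal. *)
Let cvec (a b c : R) (v : 'cV[R]_K) : {ffun 'I_3 + 'I_K -> R} :=
  [ffun i : 'I_3 + 'I_K => match i with inl j => [:: a; b; c]`_j | inr k => v k 0 end].

Let ffdot_cvec g a b c v : ffdot g (cvec a b c v) =
  g (inl 0) * a + g (inl 1) * b + g (inl (inord 2)) * c
  + dotv (\col_k g (inr k)) v.
Proof.
rewrite /ffdot big_sumType /=; congr (_ + _); last first.
  by apply: eq_bigr => k _; rewrite !ffunE mxE.
rewrite !big_ord_recl big_ord0 addr0 !ffunE /= addrA.
congr (_ * _ + _ * _ + _ * _); congr (g (inl _)); apply: val_inj => //=.
by rewrite inordK.
Qed.

(** Generators: a unit of mass moved from [i] to [j], and three slacks that may raise the cost,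
    raise the forbidden mass or lower the gain. Thus [cvec eps 0 c f] lies in the cone iff some plan
    for [f] has cost at most [eps], forbidden mass at most 0 and gain at least [c]. *)
Let column (j : 'I_K * 'I_K + 'I_3) : {ffun 'I_3 + 'I_K -> R} :=
  match j with
  | inl ij => cvec (C ij.1 ij.2) (D ij.1 ij.2) (l ij.2 0) (delta_mx ij.1 0)
  | inr i => [:: cvec 1 0 0 0; cvec 0 1 0 0; cvec 0 0 (-1) 0]`_i
  end.

Let cone_column (x : 'I_K * 'I_K + 'I_3 -> R) a b c v :
  cvec a b c v = \sum_j x j *: column j ->
  let Pi : 'M[R]_K := \matrix_(i, j) x (inl (i, j)) in
  [/\ a = frob C Pi + x (inr 0), b = frob D Pi + x (inr 1),
      c = dotv l (Pi^T *m ones) - x (inr (inord 2)) & v = Pi *m ones].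
Proof.
move=> E Pi.
have Es k : cvec a b c v k = \sum_i \sum_j Pi i j * column (inl (i, j)) k +
   (x (inr 0) * cvec 1 0 0 0 k + x (inr 1) * cvec 0 1 0 0 k
    + x (inr (inord 2)) * cvec 0 0 (-1) 0 k).
  rewrite E sum_ffunE big_sumType /=; congr (_ + _).
    rewrite pair_big /=; apply: eq_bigr => -[i j] _ /=.
    by rewrite !ffunE mxE.
  rewrite !big_ord_recl big_ord0 addr0 !addrA; congr (_ + _ + _).
  - by rewrite ffunE; congr (x (inr _) * _); apply: val_inj.
  - by rewrite ffunE; congr (x (inr _) * _); apply: val_inj.
  - rewrite ffunE; congr (x (inr _) * _); apply: val_inj => //=.
    by rewrite inordK.
split.
- have := Es (inl 0); rewrite !ffunE /= => ->.
  rewrite mulr1 !mulr0 !addr0; congr (_ + _).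
  by apply: eq_bigr => i _; apply: eq_bigr => j _; rewrite !ffunE /= mulrC.
- have := Es (inl 1); rewrite !ffunE /= => ->.
  rewrite mulr1 !mulr0 !addr0 add0r; congr (_ + _).
  by apply: eq_bigr => i _; apply: eq_bigr => j _; rewrite !ffunE /= mulrC.
- have := Es (inl (inord 2)); rewrite !ffunE /= inordK//= => ->.
  rewrite mulrN1 !mulr0 !add0r gainE; congr (_ - _).
  apply: eq_bigr => i _; apply: eq_bigr => j _.
  by rewrite !ffunE /= inordK//= mulrC.
- apply/colP => k; have := Es (inr k); rewrite !ffunE /= => ->.
  rewrite !mxE !mulr0 !addr0 (bigD1 k)//= [X in _ + X]big1 ?addr0 => [|i ik].
    by apply: eq_bigr => j _; rewrite !ffunE /= !mxE !eqxx.
  by rewrite big1// => j _; rewrite !ffunE /= !mxE eq_sym (negbTE ik) mulr0.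
Qed.

Lemma seq_argmin (T : eqType) (h : T -> R) (s : seq T) : s != [::] ->
  exists2 x, x \in s & forall y, y \in s -> h x <= h y.
Proof.
elim: s => // a s IH _; have [->|/IH[x xs hx]] := eqVneq s [::].
  by exists a; rewrite ?mem_head// => y; rewrite inE => /eqP ->.
have [ax|xa] := leP (h a) (h x).
  exists a; rewrite ?mem_head// => y; rewrite inE => /predU1P[->//|/hx].
  exact: le_trans.
exists x; rewrite ?inE ?xs ?orbT// => y; rewrite inE => /predU1P[->|/hx//].
exact: ltW.
Qed.

(** The list [V] comes before [f] in the statement. Its members are the inequalities of the cone
    that involve the gain, normalised; the point whose gain is the least dual value satisfies all
    inequalities, so it is dominated by a plan. *)
Lemma strong_duality : exists2 V : seq (R * R * 'cV[R]_K),
  forall t, t \in V -> dual_feasible l C D t &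
  forall f, nonneg f -> exists2 t, t \in V &
    exists2 Pi, transport_plans eps C D f Pi &
      dual_value t f <= dotv l (Pi^T *m ones - f).
Proof.
have [G hG] := weyl column.
(* Dividing by the negative gain coefficient reverses the inequality and turns the nonnegative
   coefficients of cost and forbidden mass into multipliers [nu, mu <= 0]. *)
pose norm (g : {ffun 'I_3 + 'I_K -> R}) : R * R * 'cV[R]_K :=
  let r := (g (inl (inord 2)))^-1 in
  (r * g (inl 0), r * g (inl 1), r *: \col_k g (inr k)).
(* Dual feasible because [l j 0] is at most the sum of the [l k 0]; it keeps the list nonempty. *)
pose t0 : R * R * 'cV[R]_K := (0, 0, const_mx (- \sum_k l k 0)).
have Gcol g j : g \in G -> 0 <= ffdot g (column j).
  move=> gG; move: (gG); apply: (hG _).1.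
  exists (fun i => (i == j)%:R) => [i|]; first exact: ler0n.
  rewrite (bigD1 j)//= eqxx scale1r big1 ?addr0// => i /negbTE ->.
  by rewrite scale0r.
have Gsgn g : g \in G -> [/\ 0 <= g (inl 0), 0 <= g (inl 1),
   g (inl (inord 2)) <= 0 & forall i j, 0 <= g (inl 0) * C i j
     + g (inl 1) * D i j + g (inl (inord 2)) * l j 0 + g (inr i)].
  have dot0 v : dotv v (0 : 'cV[R]_K) = 0 by rewrite dotvC dotv0l.
  move=> gG; split.
  - have := Gcol g (inr 0) gG.
    by rewrite /= ffdot_cvec dot0 mulr1 !mulr0 !addr0.
  - have := Gcol g (inr 1) gG.
    by rewrite /= ffdot_cvec dot0 mulr1 !mulr0 !addr0 add0r.
  - have := Gcol g (inr (inord 2)) gG.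
    rewrite /= inordK//= ffdot_cvec dot0 mulrN1 !mulr0 !addr0 add0r.
    by rewrite oppr_ge0.
  - move=> i j; have := Gcol g (inl (i, j)) gG.
    by rewrite /= ffdot_cvec dotv_delta mxE.
pose neg (g : {ffun 'I_3 + 'I_K -> R}) := g (inl (inord 2)) < 0.
exists (t0 :: [seq norm g | g <- G & neg g]).
  move=> t; rewrite inE => /predU1P[->|/mapP[g]].
    apply/dual_feasibleP; split => //= i j; rewrite !mul0r !add0r mxE lerN2.
    by rewrite (bigD1 j)//= lerDl sumr_ge0.
  rewrite mem_filter => /andP[g2 gG] ->; apply/dual_feasibleP.
  have [g0 g1 _ H] := Gsgn g gG.
  have r0 : (g (inl (inord 2)))^-1 <= 0 by rewrite invr_le0 ltW.
  split=> [||i j] /=; [exact: mulr_le0_ge0|exact: mulr_le0_ge0|].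
  have := ler_wnM2l r0 (H i j).
  rewrite mulr0 !mulrDr [X in _ + X + _]mulrA mulVf ?lt_eqF// mul1r.
  by rewrite !mxE !mulrA; lra.
move=> f f0.
set V := _ :: _.
have [t tV tmin] := seq_argmin (fun t => dual_value t f) (isT : V != [::]).
exists t => //.
have : forall g, g \in G -> 0 <= ffdot g (cvec eps 0 (dual_value t f + dotv l f) f).
  move=> g gG; rewrite ffdot_cvec mulr0 addr0.
  have [g0 g1 g2 H] := Gsgn g gG.
  move: g2; rewrite le_eqVlt => /predU1P[g2|g2].
    (* An inequality without gain holds for every [f >= 0]: the zero diagonals of [C] and [D] force
       [g (inr k) >= 0]. *)
    rewrite g2 mul0r addr0 addr_ge0 ?mulr_ge0// sumr_ge0// => k _.
    apply: mulr_ge0 => //; rewrite mxE.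
    by have := H k k; rewrite g2 hC0 hD0 !mulr0 mul0r !add0r.
  have /tmin : norm g \in V.
    by rewrite inE map_f ?orbT// mem_filter /neg g2.
  rewrite {2}/dual_value /= dotvDl dotvZl => /(ler_wnM2l (ltW g2)).
  have : g (inl (inord 2)) / g (inl (inord 2)) = 1 by rewrite mulfV ?lt_eqF.
  set a := g (inl (inord 2)); set r := a^-1; set X := dotv _ f.
  move=> ar.
  have -> : a * (- (eps * (r * g (inl 0))) - (r * X + dotv l f)) =
    - (a * r * (eps * g (inl 0))) - a * r * X - a * dotv l f by ring.
  by rewrite ar !mul1r; lra.
move=> /(hG _).2[x x0 /cone_column /=].
set Pi : 'M[R]_K := \matrix_(i, j) _; move=> [Ea Eb Ec Ef].
have Pi0 i j : 0 <= Pi i j by rewrite mxE.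
have D0 i j : 0 <= D i j by case: (hD i j) => ->.
exists Pi.
  split => //.
  - by move=> i j; rewrite mxE.
  - by rewrite Ea lerDl.
  (* The slack gives only [frob D Pi <= 0]; equality follows from [D >= 0]. *)
  - apply/eqP; rewrite eq_le; apply/andP; split; first by rewrite Eb lerDl.
    by apply: sumr_ge0 => i _; apply: sumr_ge0 => j _; apply: mulr_ge0.
by rewrite dotvBr lerBrDr Ec gerDl oppr_le0.
Qed.

End AuditDuality.

(** * Directional derivative of the audit value *)

Section Minval.
Context {R : realType} {T : eqType}.
Implicit Types (h : T -> R) (s : seq T).

Definition minval h t0 s : R := foldr (fun t m => Num.min (h t) m) (h t0) s.

Lemma minval_le h t0 s t : t \in t0 :: s -> minval h t0 s <= h t.
Proof.
elim: s => [|a s IH] /=; first by rewrite inE => /eqP ->.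
rewrite !inE orbCA => /predU1P[->|/IH]; first by rewrite ge_min lexx.
by rewrite ge_min orbC => ->.
Qed.

Lemma minval_in h t0 s : exists2 t, t \in t0 :: s & minval h t0 s = h t.
Proof.
elim: s => [|a s [t ts IH]] /=; first by exists t0; rewrite ?mem_head.
have [_|_] := leP (h a) (minval h t0 s).
  by exists a; rewrite // !inE eqxx orbT.
by exists t => //; move: ts; rewrite !inE orbCA => ->; rewrite orbT.
Qed.

Lemma minval_ge h t0 s x : (forall t, t \in t0 :: s -> x <= h t) ->
  x <= minval h t0 s.
Proof. by have [t ts ->] := minval_in h t0 s; apply. Qed.

Lemma minval_lip h g t0 s (x : R) :
  (forall t, t \in t0 :: s -> `|h t - g t| <= x) ->
  `|minval h t0 s - minval g t0 s| <= x.
Proof.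
move=> H.
have half h1 h2 : (forall t, t \in t0 :: s -> `|h1 t - h2 t| <= x) ->
    minval h1 t0 s - minval h2 t0 s <= x.
  move=> H12; have [t ts ->] := minval_in h2 t0 s.
  apply: le_trans (le_trans (ler_norm _) (H12 _ ts)).
  by rewrite lerB// minval_le.
rewrite ler_norml half// andbT lerNl opprB half// => t ts.
by rewrite distrC H.
Qed.

Lemma measurable_minval d (S : measurableType d) (h : T -> S -> R) t0 s :
  (forall t, measurable_fun setT (h t)) ->
  measurable_fun setT (fun w => minval (h^~ w) t0 s).
Proof.
by move=> mh; elim: s => //= a s IH; exact: measurable_minr.
Qed.

(** A gap below the positive values of [h]. It is used for the excess of non-optimal dual points at
    [fstar] and for the positive coordinates of [fstar]. *)
Lemma seq_pos_min h s :
  exists2 m : R, 0 < m & forall t, t \in s -> 0 < h t -> m <= h t.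
Proof.
elim: s => [|a s [m m0 H]]; first by exists 1.
have [a0|a0] := leP (h a) 0.
  by exists m => // t; rewrite inE => /predU1P[->|/H//]; rewrite ltNge a0.
exists (Num.min m (h a)); first by rewrite lt_min m0.
move=> t; rewrite inE => /predU1P[-> _|ts t0]; first by rewrite ge_min lexx orbT.
by rewrite ge_min H.
Qed.

End Minval.

Lemma dotv_bound {R : realType} {K : nat} (u v : 'cV[R]_K) (x : R) :
  (forall k, `|v k 0| <= x) -> `|dotv u v| <= (\sum_k `|u k 0|) * x.
Proof.
move=> vx; rewrite /dotv mulr_suml; apply: le_trans (ler_norm_sum _ _ _) _.
by apply: ler_sum => k _; rewrite normrM ler_wpM2l.
Qed.

Section DirectionalDerivative.
Context {R : realType} {K : nat}.
Variables (l : 'cV[R]_K) (eps : R) (C D : 'M[R]_K).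
Hypothesis hl : forall k, 0 <= l k 0.
Hypothesis heps : 0 <= eps.
Hypothesis hC0 : forall k, C k k = 0.
Hypothesis hD : forall i j, D i j = 0 \/ D i j = 1.
Hypothesis hD0 : forall k, D k k = 0.

Local Notation nonneg f := (forall k, 0 <= (f : 'cV[R]_K) k 0).
Local Notation psi := (audit_value l eps C D).
Local Notation dual := (dual_feasible l C D).
Local Notation dval := (dual_value l eps).

Lemma audit_value_outside f : ~ nonneg f -> psi f = 0.
Proof.
move=> f0; rewrite /audit_value (_ : transport_plans _ _ _ _ = set0).
  by rewrite image_set0 sup0.
rewrite -subset0 => Pi [Pi0 _ _ hf]; apply: f0 => k.
rewrite (plan_rowE k hf); apply: sumr_ge0 => j _.
by have := Pi0 k j; rewrite mxE.
Qed.

(** Stated on the whole orthant and not only on the simplex, because the perturbations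
    [fstar - r *: z] used below need not have total mass 1. *)
Lemma audit_value_min : exists2 V : seq (R * R * 'cV[R]_K),
  forall t, t \in V -> dual t &
  forall f, nonneg f -> (forall t, dual t -> psi f <= dval t f) /\
    exists2 t, t \in V & psi f = dval t f.
Proof.
have [V Vdual hV] := strong_duality hl heps hC0 hD hD0.
exists V => // f f0; have [t tV [Pi PiP tPi]] := hV f f0.
have ub s : dual s -> ubound
    [set dotv l (Pi^T *m ones - f) | Pi in transport_plans eps C D f] (dval s f).
  by move=> ds _ [Pi' Pi'P <-]; exact: weak_duality ds Pi'P.
have ne : [set dotv l (Pi^T *m ones - f) | Pi in transport_plans eps C D f] !=set0.
  by exists (dotv l (Pi^T *m ones - f)), Pi.
have le s : dual s -> psi f <= dval s f by move=> /ub; exact: ge_sup.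
split => //; exists t => //; apply/eqP.
rewrite eq_le (le t (Vdual _ tV)) /=.
apply: le_trans tPi _; apply: ub_le_sup; last by exists Pi.
by exists (dval t f); exact/ub/Vdual.
Qed.

Lemma dual_valueE t f : dval t f = - dual_objective eps f t - dotv l f.
Proof.
by case: t => -[nu mu] lam; rewrite /dual_value /= dotvDl (dotvC lam); ring.
Qed.

Lemma dual_valueB t f g : dval t f - dval t g = - dotv (t.2 + l) (f - g).
Proof. by rewrite /dual_value dotvBr; ring. Qed.

Lemma dual_argmaxP f : nonneg f -> forall t,
  dual_argmax l eps C D f t <-> dual t /\ dval t f = psi f.
Proof.
move=> f0 t; have [V Vdual /(_ f f0)[le [s sV E]]] := audit_value_min.
split.
  move=> [dt opt]; split => //; apply/eqP; rewrite eq_le le// andbT E.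
  by have := opt _ (Vdual _ sV); rewrite !dual_valueE; lra.
move=> [dt Et]; split => // t' dt'.
by have := le _ dt'; rewrite -Et !dual_valueE; lra.
Qed.

(** On the event that [X] lies in the orthant the value is a finite minimum of affine functions of
    [X]; elsewhere it is the junk value 0. *)
Lemma audit_value_measurable d (T : measurableType d) (X : T -> 'cV[R]_K) :
  random_vector X -> measurable_fun setT (fun w => psi (X w)).
Proof.
move=> mX; have [V Vdual hV] := audit_value_min.
have [t0 [s VE]] : exists t0 s, V = t0 :: s.
  have [|_ [t tV _]] := hV 0; first by move=> k; rewrite mxE.
  by case: V tV {Vdual hV} => // a s _; exists a, s.
pose pos := \bigcap_(k in [set: 'I_K]) [set w | 0 <= X w k 0].
have mpos : measurable pos.
  apply: fin_bigcap_measurable => // k _.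
  by rewrite -[X in measurable X]setTI; exact: measurable_fun_le.
have mdval t : measurable_fun setT (fun w => dval t (X w)).
  apply: measurable_funB => //; apply: measurable_sum => k.
  exact: measurable_funM.
rewrite (_ : (fun w => _) = (fun w => if w \in pos then
   minval (fun t => dval t (X w)) t0 s else 0)).
  apply: measurable_fun_ifT => //; last exact: measurable_minval.
  by apply: (measurable_fun_bool true); rewrite setTI preimage_mem_true.
apply/funext => w; case: ifPn => [/set_mem wpos|/negP wpos]; last first.
  apply: audit_value_outside => w0; apply: wpos; apply/mem_set => k _.
  exact: w0.
have [|le [t tV E]] := hV (X w); first by move=> k; exact: wpos.
apply/eqP; rewrite eq_le; apply/andP; split.
  by apply: minval_ge => u uV; apply/le/Vdual; rewrite VE.
by rewrite E minval_le// -VE.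
Qed.

(* [phi] is the directional derivative of the audit value at [fstar], taken
   along the directions that stay in the nonnegative orthant. *)
Lemma audit_value_derivative fstar : nonneg fstar ->
  exists phi : 'cV[R]_K -> R,
  [/\ exists2 delta, 0 < delta & forall f, nonneg f ->
        (forall k, `|f k 0 - fstar k 0| <= delta) ->
        psi f - psi fstar = phi (f - fstar),
      forall a (z : 'cV[R]_K), 0 <= a -> phi (a *: z) = a * phi z,
      exists2 L, 0 <= L & forall (x y : 'cV[R]_K) (r : R),
        (forall k, `|x k 0 - y k 0| <= r) -> `|phi x - phi y| <= L * r,
      forall d (T : measurableType d) (X : T -> 'cV[R]_K),
        random_vector X -> measurable_fun setT (phi \o X) &
      forall z : 'cV[R]_K, (forall k, fstar k 0 = 0 -> z k 0 = 0) ->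
        ereal_inf [set (dotv (t.2 + l) z)%:E | t in dual_argmax l eps C D fstar]
        = (phi (- z))%:E].
Proof.
move=> fs0; have [V Vdual hV] := audit_value_min.
pose act t := dval t fstar == psi fstar.
have [t0 [s AE]] : exists t0 s, [seq t <- V | act t] = t0 :: s.
  have [_ [t tV /esym/eqP E]] := hV _ fs0.
  have : t \in [seq t <- V | act t] by rewrite mem_filter tV /act E.
  by case: [seq t <- V | act t] => // a s _; exists a, s.
have actP t : t \in t0 :: s -> t \in V /\ dval t fstar = psi fstar.
  by rewrite -AE mem_filter => /andP[/eqP].
pose phi (z : 'cV[R]_K) : R := minval (fun t => - dotv (t.2 + l) z) t0 s.
pose L : R := \sum_(t <- V) \sum_k `|(t.2 + l) k 0|.
have L0 : 0 <= L by apply: sumr_ge0 => t _; exact: sumr_ge0.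
have Lb (t : R * R * 'cV[R]_K) (z : 'cV[R]_K) (r : R) : t \in V -> (forall k, `|z k 0| <= r) -> 0 <= r ->
    `|dotv (t.2 + l) z| <= L * r.
  move=> tV zr r0; apply: le_trans (dotv_bound _ zr) _; apply: ler_wpM2r => //.
  rewrite /L (big_rem t)//= lerDl; apply: sumr_ge0 => u _; exact: sumr_ge0.
have phi_in z : exists2 t, t \in t0 :: s & phi z = - dotv (t.2 + l) z.
  exact: minval_in.
have phi_le z t : t \in t0 :: s -> phi z <= - dotv (t.2 + l) z.
  exact: (minval_le (fun t => - dotv (t.2 + l) z)).
have phiZ a z : 0 <= a -> phi (a *: z) = a * phi z.
  move=> a0; apply/eqP; rewrite eq_le; apply/andP; split.
    by have [t ts ->] := phi_in z; rewrite mulrN -dotvZr phi_le.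
  by have [t ts ->] := phi_in (a *: z); rewrite dotvZr -mulrN ler_wpM2l// phi_le.
have [gam gam0 hgam] := seq_pos_min (fun t => dval t fstar - psi fstar) V.
have L1 : 0 < 2 * L + 1 by lra.
(* A displacement of size [delta] changes each of two dual values by at most [L * delta], together
   less than the gap [gam]; the [+ 1] avoids a zero denominator. *)
pose delta := gam / (2 * L + 1).
have delta0 : 0 < delta by exact: divr_gt0.
have Ldelta : 2 * (L * delta) < gam.
  by rewrite /delta !mulrA ltr_pdivrMr// mulrC ltr_pM2l//; lra.
have local f : nonneg f -> (forall k, `|f k 0 - fstar k 0| <= delta) ->
    psi f - psi fstar = phi (f - fstar).
  move=> f0 ffs; have [le [t tV E]] := hV f f0.
  have ffs' k : `|(f - fstar) k 0| <= delta by rewrite !mxE.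
  have le' : psi f - psi fstar <= phi (f - fstar).
    apply: minval_ge => u /actP[uV <-]; rewrite -dual_valueB lerB//.
    exact/le/Vdual.
  apply/eqP; rewrite eq_le le' /=.
  have [ta|ta] := boolP (act t).
    rewrite E -(eqP ta) dual_valueB; apply: phi_le.
    by rewrite -AE mem_filter ta tV.
  have tgt : 0 < dval t fstar - psi fstar.
    rewrite subr_gt0 lt_neqAle eq_sym ta /=.
    by have [+ _] := hV _ fs0; apply; exact: Vdual.
  (* At [fstar] the inactive [t] exceeds the active [t0] by at least [gam]. This excess cannot be
     used up on the way to [f], so [t] is not optimal there. *)
  exfalso.
  have [t0V t0E] := actP t0 (mem_head _ _).
  have := hgam t tV tgt; have := Lb t _ _ tV ffs' (ltW delta0).
  have := le _ (Vdual _ t0V); have := Lb t0 _ _ t0V ffs' (ltW delta0).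
  have := dual_valueB t f fstar; have := dual_valueB t0 f fstar.
  rewrite !ler_norml => e1 e2 /andP[a1 a2] a3 /andP[a4 a5] a6.
  by move: e1 e2 a1 a2 a3 a4 a5 a6 Ldelta; rewrite E t0E; lra.
exists phi; split => //.
- by exists delta.
- exists L => // x y r xyr; apply: minval_lip => t /actP[tV _].
  (* That [r >= 0] is read off a coordinate; if there is none, [L] and the form are both 0. *)
  rewrite opprK addrC -dotvBr; have [k _|K0] := pickP 'I_K.
    apply: Lb => //; first by move=> i; rewrite !mxE distrC.
    exact: le_trans (xyr k).
  rewrite /dotv big_pred0// normr0.
  have -> : L = 0.
    by rewrite /L big1// => u _; rewrite big_pred0.
  by rewrite mul0r.
- move=> d T X mX; apply: measurable_minval => t.
  apply: measurableT_comp => //; apply: measurable_sum => k.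
  exact: measurable_funM.
(* The active list gives one inequality. For the other, an arbitrary dual optimum is compared with
   the value at [fstar - r *: z], which remains in the orthant because [z] vanishes where [fstar]
   does. *)
- move=> z hz.
  have [m m0 hm] := seq_pos_min (fun k => fstar k 0) (enum 'I_K).
  pose S := 1 + \sum_k `|z k 0|.
  have S0 : 0 < S by rewrite ltr_pwDl// sumr_ge0.
  have zS k : `|z k 0| <= S.
    rewrite /S (bigD1 k)//=.
    have : 0 <= \sum_(i < K | i != k) `|z i 0| by exact: sumr_ge0.
    lra.
  (* Small enough that the positive coordinates of [fstar], all at least [m], stay nonnegative and
     that the local formula applies. *)
  pose r := Num.min m delta / S.
  have md0 : 0 < Num.min m delta by rewrite lt_min m0.
  have r0 : 0 < r by exact: divr_gt0.
  have rz k : `|r * z k 0| <= Num.min m delta.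
    rewrite normrM gtr0_norm// /r -mulrA ler_piMr ?(ltW md0)// mulrC.
    by rewrite ler_pdivrMr// mul1r.
  have fz0 : nonneg (fstar - r *: z).
    move=> k; rewrite !mxE subr_ge0.
    have := fs0 k; rewrite le_eqVlt => /predU1P[/esym E|k0].
      by rewrite E hz// mulr0.
    apply: le_trans (le_trans (ler_norm _) (rz k)) _.
    by rewrite ge_min hm// mem_enum.
  have key t : dual_argmax l eps C D fstar t -> phi (- z) <= dotv (t.2 + l) z.
    move=> /(dual_argmaxP fs0 _)[dt Et].
    rewrite -(ler_pM2l r0) -phiZ ?(ltW r0)//.
    have -> : r *: - z = (fstar - r *: z) - fstar.
      by rewrite addrC addKr scalerN.
    rewrite -local//; last first.
      move=> k; have -> : (fstar - r *: z) k 0 - fstar k 0 = - (r * z k 0).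
        by rewrite !mxE; ring.
      rewrite normrN.
      by apply: le_trans (rz k) _; rewrite ge_min lexx orbT.
    rewrite -dotvZr -Et -[dotv _ (r *: z)]opprK.
    have -> : - dotv (t.2 + l) (r *: z) = dval t fstar - dval t (fstar - r *: z).
      by rewrite dual_valueB opprB [fstar + _]addrC subrK.
    by rewrite (opprB (dval t fstar)) lerB//; have [+ _] := hV _ fz0; apply.
  apply/eqP; rewrite eq_le; apply/andP; split.
    have [t ts E] := phi_in (- z).
    apply: ereal_inf_lbound; exists t; last by rewrite E dotvNr opprK.
    by apply/(dual_argmaxP fs0 _); have [tV <-] := actP _ ts; split => //; exact: Vdual.
  by apply: le_ereal_inf_tmp => _ [t /key h <-]; rewrite lee_fin.
Qed.

End DirectionalDerivative.

(** * Random walk functionals *)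

Section Walk.
Context {R : realType} {K : nat} {S : finType}.
Variables (w : S -> R) (e : S -> 'cV[R]_K).
Implicit Types (h g : 'cV[R]_K -> R) (n : nat).

(* Expectation of [h] at the [n]-th position of the random walk started at the
   origin whose steps equal [e s] with probability [w s]. *)
Fixpoint walk n h : R :=
  if n is m.+1 then \sum_s w s * walk m (fun x => h (x + e s)) else h 0.

Lemma walkD n h g : walk n (fun x => h x + g x) = walk n h + walk n g.
Proof.
elim: n h g => //= n IH h g; rewrite -big_split; apply: eq_bigr => s _ /=.
by rewrite IH mulrDr.
Qed.

Lemma walkZ n (a : R) h : walk n (fun x => a * h x) = a * walk n h.
Proof.
elim: n h => //= n IH h; rewrite mulr_sumr; apply: eq_bigr => s _.
by rewrite IH mulrCA.
Qed.

Lemma walkB n h g : walk n (fun x => h x - g x) = walk n h - walk n g.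
Proof.
rewrite walkD; congr (_ + _); rewrite -mulN1r -walkZ; congr walk.
by apply/funext => x; rewrite mulN1r.
Qed.

Lemma walk_sum (J : Type) (r : seq J) n (h : J -> 'cV[R]_K -> R) :
  walk n (fun x => \sum_(j <- r) h j x) = \sum_(j <- r) walk n (h j).
Proof.
elim: r => [|j r IH].
  rewrite big_nil [X in walk n X](_ : _ = fun x => 0 * 0).
    by rewrite (walkZ n 0 (fun=> 0)) mul0r.
  by apply/funext => x; rewrite big_nil mul0r.
rewrite big_cons -IH -walkD; congr walk; apply/funext => x.
by rewrite big_cons.
Qed.

Hypothesis w0 : forall s, 0 <= w s.

Lemma le_walk n h g : (forall x, h x <= g x) -> walk n h <= walk n g.
Proof.
elim: n h g => [|n IH] h g hg /=; first exact: hg.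
by apply: ler_sum => s _; apply: ler_wpM2l => //; apply: IH => x.
Qed.

Hypothesis w1 : \sum_s w s = 1.

Lemma walk_cst n (a : R) : walk n (fun=> a) = a.
Proof. by elim: n => //= n IH; rewrite IH -mulr_suml w1 mul1r. Qed.

Lemma walk_norm_le n h (B : R) : (forall x, `|h x| <= B) -> `|walk n h| <= B.
Proof.
move=> hB; rewrite ler_norml; apply/andP; split.
  rewrite -[leLHS](walk_cst n (- B)); apply: le_walk => x.
  by have := hB x; rewrite ler_norml => /andP[].
rewrite -[leRHS](walk_cst n B); apply: le_walk => x.
exact: le_trans (ler_norm _) (hB x).
Qed.

Lemma le_walk_norm n h : `|walk n h| <= walk n (fun x => `|h x|).
Proof.
rewrite ler_norml; apply/andP; split; last by apply: le_walk => x; exact: ler_norm.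
rewrite -mulN1r -walkZ; apply: le_walk => x.
by rewrite mulN1r lerNl -normrN; exact: ler_norm.
Qed.

Variable a : 'cV[R]_K.
Let m : R := \sum_s w s * dotv a (e s).

(** The shift [b] absorbs the steps already made in the induction; the cross terms vanish since the
    centred steps have mean zero. *)
Lemma walk_second_moment n (b : R) :
  walk n (fun x => (b + (dotv a x - n%:R * m)) ^+ 2) =
  b ^+ 2 + n%:R * \sum_s w s * (dotv a (e s) - m) ^+ 2.
Proof.
elim: n b => [|n IH] b /=.
  by rewrite mul0r subr0 mul0r addr0 dotvC dotv0l addr0.
set v := \sum_s _ * _ ^+ 2.
rewrite [LHS](_ : _ = \sum_s w s * ((b + (dotv a (e s) - m)) ^+ 2 + n%:R * v));
  last first.
  apply: eq_bigr => s _; rewrite -IH; congr (_ * walk n _).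
  by apply/funext => x; rewrite dotvDr mulrS; congr (_ ^+ 2); ring.
rewrite (eq_bigr (fun s => w s * b ^+ 2 + 2 * b * (w s * dotv a (e s) - w s * m)
  + w s * (dotv a (e s) - m) ^+ 2 + w s * (n%:R * v))); last by move=> s _; ring.
rewrite !big_split /= -!mulr_suml -mulr_sumr sumrB -!mulr_suml w1 -/m !mul1r subrr mulr0.
by rewrite addr0 mulrS mulrDl mul1r addrA.
Qed.

(** The real form of taking the [n]-th power of a characteristic function: steps are replaced by the
    factor [q] one at a time, the phase absorbs the step made, and [0 <= q <= 1] keeps each error at
    most [delta]. *)
Lemma walk_cos n (t q delta b : R) : 0 <= q <= 1 ->
  (forall c, `|\sum_s w s * cos (c + t * (dotv a (e s) - m)) - q * cos c| <= delta) ->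
  `|walk n (fun x => cos (b + t * (dotv a x - n%:R * m))) - q ^+ n * cos b|
    <= n%:R * delta.
Proof.
move=> /andP[q0 q1] H; elim: n b => [|n IH] b /=.
  by rewrite dotvC dotv0l !mul0r subr0 mulr0 addr0 expr0 mul1r subrr normr0.
set F := \sum_s _.
have -> : F = \sum_s w s * walk n (fun x =>
    cos ((b + t * (dotv a (e s) - m)) + t * (dotv a x - n%:R * m))).
  apply: eq_bigr => s _; congr (_ * walk n _); apply/funext => x; congr cos.
  by rewrite dotvDr mulrS; ring.
rewrite [X in `|X|](_ : _ = \sum_s w s * (walk n (fun x =>
    cos ((b + t * (dotv a (e s) - m)) + t * (dotv a x - n%:R * m)))
    - q ^+ n * cos (b + t * (dotv a (e s) - m))) +
  q ^+ n * (\sum_s w s * cos (b + t * (dotv a (e s) - m)) - q * cos b)).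
  have -> : n.+1%:R * delta = n%:R * delta + delta by rewrite mulrS; ring.
  apply: le_trans (ler_normD _ _) _; apply: lerD; last first.
    rewrite normrM ger0_norm ?exprn_ge0// -[leRHS]mul1r.
    by apply: ler_pM => //; rewrite ?exprn_ge0// exprn_ile1.
  apply: le_trans (ler_norm_sum _ _ _) _.
  have -> : n%:R * delta = \sum_s w s * (n%:R * delta).
    by rewrite -mulr_suml w1 mul1r.
  apply: ler_sum => s _.
  by rewrite normrM ger0_norm// ler_wpM2l.
rewrite [X in _ = X + _](eq_bigr (fun s => w s * walk n (fun x =>
    cos ((b + t * (dotv a (e s) - m)) + t * (dotv a x - n%:R * m)))
    - q ^+ n * (w s * cos (b + t * (dotv a (e s) - m))))); last by move=> s _; ring.
by rewrite sumrB -mulr_sumr exprS; ring.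
Qed.

End Walk.

(** * Taylor bounds *)

Section TaylorBounds.
Context {R : realType}.
Implicit Types x t : R.

(** Repeated use climbs the Taylor expansions: each sine or cosine bound below is the sign of the
    derivative for the next one. *)
Lemma derive_ge0_le (f df : R -> R) x : (forall y : R, is_derive y 1 f (df y)) ->
  (forall y, 0 <= y -> 0 <= df y) -> 0 <= x -> f 0 <= f x.
Proof.
move=> fdf df0 x0.
have cf : {within `[0, x], continuous f}.
  apply: continuous_subspaceT => y.
  by apply/differentiable_continuous/derivable1_diffP; have [] := fdf y.
have [c cx] := MVT_segment x0 (fun y _ => fdf y) cf.
rewrite subr0 -subr_ge0 => ->; apply: mulr_ge0 => //; apply: df0.
by move: cx; rewrite in_itv /= => /andP[].
Qed.

Lemma sin_le_id x : 0 <= x -> sin x <= x.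
Proof.
have D (y : R) : is_derive y 1 (fun x : R => x - sin x) (1 - cos y).
  exact: is_deriveB.
have D0 (y : R) : 0 <= y -> 0 <= 1 - cos y by rewrite subr_ge0 cos_le1.
by move=> /(derive_ge0_le D D0); rewrite sin0 subr0 subr_ge0.
Qed.

Lemma cos_ge_quad x : 1 - x ^+ 2 / 2 <= cos x.
Proof.
wlog x0 : x / 0 <= x => [H|].
  by have [/H//|/ltW x0] := leP 0 x; rewrite -cosN -sqrrN H// oppr_ge0.
have D (y : R) : is_derive y 1 (fun x : R => cos x + x ^+ 2 / 2) (y - sin y).
  apply: is_derive_eq; rewrite /GRing.scale /=; lra.
have D0 (y : R) : 0 <= y -> 0 <= y - sin y by move=> ?; rewrite subr_ge0 sin_le_id.
have := derive_ge0_le D D0 x0; rewrite cos0 expr0n /=; lra.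
Qed.

Lemma sin_ge_cubic x : 0 <= x -> x - x ^+ 3 / 6 <= sin x.
Proof.
move=> x0.
have D (y : R) : is_derive y 1 (fun x : R => sin x - x + x ^+ 3 / 6)
    (cos y - 1 + y ^+ 2 / 2).
  apply: is_derive_eq; rewrite /GRing.scale /=; lra.
have D0 (y : R) : 0 <= y -> 0 <= cos y - 1 + y ^+ 2 / 2.
  by move=> _; have := cos_ge_quad y; lra.
have := derive_ge0_le D D0 x0; rewrite sin0 expr0n /=; lra.
Qed.

Lemma cos_le_quartic x : cos x <= 1 - x ^+ 2 / 2 + x ^+ 4 / 24.
Proof.
wlog x0 : x / 0 <= x => [H|].
  have [/H//|/ltW x0] := leP 0 x.
  have := H (- x); rewrite oppr_ge0 cosN => /(_ x0).
  by rewrite sqrrN (_ : (- x) ^+ 4 = x ^+ 4) //; ring.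
have D (y : R) : is_derive y 1 (fun x : R => 1 - x ^+ 2 / 2 + x ^+ 4 / 24 - cos x)
    (sin y - y + y ^+ 3 / 6).
  apply: is_derive_eq; rewrite /GRing.scale /=; lra.
have D0 (y : R) : 0 <= y -> 0 <= sin y - y + y ^+ 3 / 6.
  by move=> y0; have := sin_ge_cubic y0; lra.
have := derive_ge0_le D D0 x0; rewrite cos0 !expr0n /=; lra.
Qed.

Lemma expRN_le_quad x : 0 <= x -> expR (- x) <= 1 - x + x ^+ 2 / 2.
Proof.
move=> x0.
have D (y : R) : is_derive y 1 (fun x : R => 1 - x + x ^+ 2 / 2 - expR (- x))
    (- 1 + y + expR (- y)).
  apply: is_derive_eq; rewrite /GRing.scale /=; lra.
have D0 (y : R) : 0 <= y -> 0 <= - 1 + y + expR (- y).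
  by move=> _; have := expR_ge1Dx (- y); lra.
have := derive_ge0_le D D0 x0; rewrite oppr0 expR0 expr0n /=; lra.
Qed.

Lemma cos_taylor x : `|cos x - 1 + x ^+ 2 / 2| <= x ^+ 4.
Proof.
have := cos_ge_quad x; have := cos_le_quartic x.
have : 0 <= x ^+ 4 by rewrite (exprM x 2 2) sqr_ge0.
by rewrite ler_norml; lra.
Qed.

Lemma sin_taylor x : `|sin x - x| <= `|x| ^+ 3.
Proof.
wlog x0 : x / 0 <= x => [H|].
  have [/H//|/ltW x0] := leP 0 x.
  by have := H (- x); rewrite oppr_ge0 => /(_ x0); rewrite sinN -opprD !normrN.
have := sin_le_id x0; have := sin_ge_cubic x0.
have : 0 <= x ^+ 3 by exact: exprn_ge0.
by rewrite (ger0_norm x0) ler_norml; lra.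
Qed.

Lemma expRN_taylor x : 0 <= x -> `|expR (- x) - 1 + x| <= x ^+ 2.
Proof.
move=> x0; have := expRN_le_quad x0; have := expR_ge1Dx (- x).
by have := sqr_ge0 x; rewrite ler_norml; lra.
Qed.

End TaylorBounds.

(** * Cosine expectation of a single centred step *)

Section StepCos.
Context {R : realType} {S : finType}.
Variables (w xi : S -> R).
Hypothesis w0 : forall s, 0 <= w s.
Hypothesis w1 : \sum_s w s = 1.
Hypothesis xi_mean : \sum_s w s * xi s = 0.

(** After the addition formula the mean-zero condition kills the linear sine term, and the quadratic
    terms of cosine and exponential cancel. The remainder is cubic uniformly in the phase [b], so
    for [t] equal to the inverse square root of [n] it survives [n] repetitions. *)
Lemma step_cos : exists2 c : R, 0 <= c & forall t b, 0 <= t <= 1 ->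
  `|\sum_s w s * cos (b + t * xi s)
    - expR (- (t ^+ 2 * (\sum_s w s * xi s ^+ 2) / 2)) * cos b| <= c * t ^+ 3.
Proof.
set v := \sum_s w s * xi s ^+ 2.
have v0 : 0 <= v by apply: sumr_ge0 => s _; rewrite mulr_ge0// sqr_ge0.
pose c3 := \sum_s w s * `|xi s| ^+ 3; pose c4 := \sum_s w s * xi s ^+ 4.
have x4 (x : R) : 0 <= x ^+ 4 by rewrite (exprM x 2 2) sqr_ge0.
have c30 : 0 <= c3 by apply: sumr_ge0 => s _; rewrite mulr_ge0// exprn_ge0.
have c40 : 0 <= c4 by apply: sumr_ge0 => s _; rewrite mulr_ge0.
exists (c4 + c3 + v ^+ 2); first by rewrite !addr_ge0// sqr_ge0.
move=> t b /andP[t0 t1].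
set q := expR _.
pose A := \sum_s w s * (cos (t * xi s) - 1 + (t * xi s) ^+ 2 / 2).
pose B := \sum_s w s * (sin (t * xi s) - t * xi s).
pose E := q - 1 + t ^+ 2 * v / 2.
have -> : \sum_s w s * cos (b + t * xi s) - q * cos b =
    cos b * A - sin b * B - cos b * E.
  have EA : A = \sum_s w s * cos (t * xi s) - 1 + t ^+ 2 * v / 2.
    rewrite /A (eq_bigr (fun s => w s * cos (t * xi s) - w s
      + t ^+ 2 / 2 * (w s * xi s ^+ 2))); last by move=> s _; field.
    by rewrite big_split /= sumrB w1 -mulr_sumr -/v; field.
  have EB : B = \sum_s w s * sin (t * xi s).
    rewrite /B (eq_bigr (fun s => w s * sin (t * xi s) - t * (w s * xi s))).
      by rewrite sumrB -mulr_sumr xi_mean mulr0 subr0.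
    by move=> s _; ring.
  have -> : \sum_s w s * cos (b + t * xi s) =
     cos b * \sum_s w s * cos (t * xi s) - sin b * \sum_s w s * sin (t * xi s).
    by rewrite !mulr_sumr -sumrB; apply: eq_bigr => s _; rewrite cosD; ring.
  by rewrite EA EB /E; ring.
have t43 : t ^+ 4 <= t ^+ 3 by apply: ler_wiXn2l.
have HA : `|A| <= c4 * t ^+ 3.
  apply: (@le_trans _ _ (c4 * t ^+ 4)); last by rewrite ler_wpM2l.
  apply: le_trans (ler_norm_sum _ _ _) _; rewrite mulr_suml.
  apply: ler_sum => s _; rewrite normrM ger0_norm// -mulrA ler_wpM2l//.
  by rewrite mulrC -exprMn; exact: cos_taylor.
have HB : `|B| <= c3 * t ^+ 3.
  apply: le_trans (ler_norm_sum _ _ _) _; rewrite mulr_suml.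
  apply: ler_sum => s _; rewrite normrM ger0_norm// -mulrA ler_wpM2l//.
  apply: le_trans (sin_taylor _) _.
  by rewrite normrM exprMn (ger0_norm t0) mulrC.
have HE : `|E| <= v ^+ 2 * t ^+ 3.
  apply: (@le_trans _ _ (v ^+ 2 * t ^+ 4)); last by rewrite ler_wpM2l// sqr_ge0.
  have u0 : 0 <= t ^+ 2 * v / 2 by rewrite !mulr_ge0// sqr_ge0.
  apply: le_trans (expRN_taylor u0) _.
  have : 0 <= v ^+ 2 * t ^+ 4 by rewrite mulr_ge0 ?sqr_ge0.
  have -> : (t ^+ 2 * v / 2) ^+ 2 = v ^+ 2 * t ^+ 4 / 4 by field.
  lra.
have cs x y : `|x| <= 1 -> `|x * y| <= `|y| :> R.
  by move=> x1; rewrite normrM ler_piMl.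
apply: le_trans (ler_normB _ _) _; rewrite !mulrDl; apply: lerD.
  apply: le_trans (ler_normB _ _) _; apply: lerD.
    by apply: le_trans HA; apply: cs; rewrite ler_norml cos_geN1 cos_le1.
  by apply: le_trans HB; apply: cs; rewrite ler_norml sin_geN1 sin_le1.
by apply: le_trans HE; apply: cs; rewrite ler_norml cos_geN1 cos_le1.
Qed.

End StepCos.

(** * Trigonometric approximation *)

(** A step with values in [[0, 1]] deviates from its mean by at most 1, so each step adds at most 1
    to the variance. *)
Lemma walk_coord_variance {R : realType} {K : nat} {S : finType}
    (w : S -> R) (e : S -> 'cV[R]_K) (a : 'cV[R]_K) n :
  (forall s, 0 <= w s) -> \sum_s w s = 1 -> (forall s, 0 <= dotv a (e s) <= 1) ->
  walk w e n (fun x => (dotv a x - n%:R * \sum_s w s * dotv a (e s)) ^+ 2) <= n%:R.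
Proof.
move=> w0 w1 a01; set m := \sum_s _.
have := walk_second_moment e w1 a n 0; rewrite -/m expr0n add0r => E.
rewrite [X in walk _ _ _ X](_ : _ = fun x => (0 + (dotv a x - n%:R * m)) ^+ 2).
  rewrite E ler_piMr//; rewrite -w1; apply: ler_sum => s _.
  rewrite ler_piMr// -[_ ^+ 2]ger0_norm ?sqr_ge0// normrX expr_le1//.
  have /andP[m0 m1] : 0 <= m <= 1.
    rewrite /m sumr_ge0 => [|i _]; last by rewrite mulr_ge0//; case/andP: (a01 i).
    rewrite -w1; apply: ler_sum => i _.
    by rewrite ler_piMr//; case/andP: (a01 i).
  by have /andP[s0 s1] := a01 s; rewrite ler_norml; lra.
by apply/funext => x; rewrite add0r.
Qed.

Lemma sum_option {R : realType} {I : finType} (F : option I -> R) :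
  \sum_s F s = F None + \sum_i F (Some i).
Proof.
rewrite (bigD1 None)//= (reindex_omap Some id) => [|[i|]//].
by congr (_ + _); apply: eq_bigl => i; rewrite eqxx.
Qed.

Section TrigonometricPolynomials.
Context {R : realType} {K : nat}.
Implicit Types h f g : 'cV[R]_K -> R.

(** The phase makes sines available and lets a product of two cosines be a sum of cosines again. *)
Inductive trigpoly : ('cV[R]_K -> R) -> Prop :=
| trigpoly_cos a b : trigpoly (fun x => cos (dotv a x + b))
| trigpolyZ (c : R) f : trigpoly f -> trigpoly (fun x => c * f x)
| trigpolyD f g : trigpoly f -> trigpoly g -> trigpoly (fun x => f x + g x).

Lemma trigpoly_cst (c : R) : trigpoly (fun=> c).
Proof.
rewrite (_ : (fun=> c) = fun x => c * cos (dotv 0 x + 0)).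
  exact/trigpolyZ/trigpoly_cos.
by apply/funext => x; rewrite dotv0l addr0 cos0 mulr1.
Qed.

Lemma trigpolyM f g : trigpoly f -> trigpoly g -> trigpoly (fun x => f x * g x).
Proof.
move=> tf tg; elim: tf => [a b|c {}f _ IH|f1 f2 _ IH1 _ IH2].
- elim: tg => [a' b'|c {}g _ IH|g1 g2 _ IH1 _ IH2].
  + rewrite (_ : (fun x => _) = fun x =>
        2^-1 * (cos (dotv (a + a') x + (b + b')) + cos (dotv (a - a') x + (b - b')))).
      by apply/trigpolyZ/trigpolyD; exact: trigpoly_cos.
    apply/funext => x; rewrite dotvDl dotvBl.
    have -> : dotv a x + dotv a' x + (b + b') = (dotv a x + b) + (dotv a' x + b').
      by ring.
    have -> : dotv a x - dotv a' x + (b - b') = (dotv a x + b) - (dotv a' x + b').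
      by ring.
    set A := dotv a x + b; set A' := dotv a' x + b'.
    by rewrite cosB cosD; field.
  + rewrite (_ : (fun x => _) = fun x => c * (cos (dotv a x + b) * g x)).
      exact: trigpolyZ.
    by apply/funext => x; rewrite mulrCA.
  + rewrite (_ : (fun x => _) = fun x =>
        cos (dotv a x + b) * g1 x + cos (dotv a x + b) * g2 x).
      exact: trigpolyD.
    by apply/funext => x; rewrite mulrDr.
- rewrite (_ : (fun x => _) = fun x => c * (f x * g x)); first exact: trigpolyZ.
  by apply/funext => x; rewrite mulrA.
- rewrite (_ : (fun x => _) = fun x => f1 x * g x + f2 x * g x).
    exact: trigpolyD.
  by apply/funext => x; rewrite mulrDl.
Qed.

Lemma trigpoly_sum (J : Type) (r : seq J) (f : J -> 'cV[R]_K -> R) :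
  (forall j, trigpoly (f j)) -> trigpoly (fun x => \sum_(j <- r) f j x).
Proof.
move=> tf; elim: r => [|j r IH].
  rewrite (_ : (fun x => _) = fun=> 0); first exact: trigpoly_cst.
  by apply/funext => x; rewrite big_nil.
rewrite (_ : (fun x => _) = fun x => f j x + \sum_(j <- r) f j x).
  exact: trigpolyD.
by apply/funext => x; rewrite big_cons.
Qed.

(** The walk expectation is a polynomial in the step weights with values of [h] as coefficients,
    which is how Bernstein polynomials arise here. *)
Lemma trigpoly_walk (S : finType) (w : 'cV[R]_K -> S -> R) (e : S -> 'cV[R]_K) n h :
  (forall s, trigpoly (w^~ s)) -> trigpoly (fun x => walk (w x) e n h).
Proof.
move=> tw; elim: n h => [|n IH] h /=; first exact: trigpoly_cst.
by apply: trigpoly_sum => s; apply: trigpolyM.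
Qed.

(** Only [x] is confined to the cube: the Bernstein nodes compared with it may lie outside. *)
Definition loc_unif_continuous h := forall M eps : R, 0 < eps ->
  exists2 delta : R, 0 < delta & forall x y : 'cV[R]_K,
    (forall k, `|x k 0| <= M) -> (forall k, `|x k 0 - y k 0| <= delta) ->
    `|h x - h y| <= eps.

Lemma sin_scale_approx (M delta : R) : 0 < delta -> exists2 beta : R, 0 < beta &
  forall x, `|x| <= M -> `|sin (beta * x) / beta - x| <= delta.
Proof.
move=> d0; pose M3 := `|M| ^+ 3 + 1.
have M30 : 0 < M3 by rewrite ltr_wpDl// exprn_ge0.
(* The error is at most [beta ^+ 2 * M3], hence at most [beta * M3] as [beta <= 1]. *)
pose beta := Num.min 1 (delta / M3).
have b0 : 0 < beta by rewrite lt_min ltr01 divr_gt0.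
exists beta => // x xM.
have -> : sin (beta * x) / beta - x = (sin (beta * x) - beta * x) / beta.
  by field; rewrite gt_eqF.
rewrite normrM normfV (gtr0_norm b0) ler_pdivrMr//.
apply: le_trans (sin_taylor _) _; rewrite normrM (gtr0_norm b0) exprMn exprS.
rewrite -mulrA mulrC ler_wpM2r ?(ltW b0)//.
have x3 : `|x| ^+ 3 <= M3.
  apply: (@le_trans _ _ (`|M| ^+ 3)); last by rewrite lerDl.
  by rewrite lerXn2r ?nnegrE//; apply: le_trans xM (ler_norm _).
apply: (@le_trans _ _ (beta * M3)).
  apply: ler_pM => //; rewrite ?exprn_ge0 ?(ltW b0)//.
  by rewrite expr2 ler_piMr ?(ltW b0)// ge_min lexx.
by rewrite -ler_pdivlMr// ge_min lexx orbT.
Qed.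

(* Bernstein polynomials on the simplex, in the variables
   [(1 + sin (beta * x k 0)) / 2]: for small [beta] these are nearly affine in
   [x] on the given cube, and staying in [0, 1] they keep the approximant bounded
   on the whole space. *)
Lemma trigpoly_approx h (B M eps : R) : (0 < K)%N ->
  (forall x, `|h x| <= B) -> loc_unif_continuous h -> 0 < eps ->
  exists f, [/\ trigpoly f, forall x, `|f x| <= B &
    forall x : 'cV[R]_K, (forall k, `|x k 0| <= M) -> `|h x - f x| <= eps].
Proof.
move=> K0 hB hc eps0.
have kap0 : 0 < K%:R :> R by rewrite ltr0n.
have B0 : 0 <= B by apply: le_trans (hB 0).
have [delta d0 hdelta] := hc M (eps / 2) (divr_gt0 eps0 (ltr0Sn _ _)).
have [beta b0 hbeta] := sin_scale_approx M (divr_gt0 d0 (ltr0Sn _ 1)).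
pose u (x : 'cV[R]_K) k : R := (1 + sin (beta * x k 0)) / 2.
have u01 x k : 0 <= u x k <= 1.
  have := sin_geN1 (beta * x k 0); have := sin_le1 (beta * x k 0).
  by rewrite /u; lra.
(* Division by [K] keeps the total weight of the unit steps at most 1; [None] means staying put with
   the remaining weight. *)
pose w x (s : option 'I_K) : R :=
  if s is Some k then u x k / K%:R else 1 - \sum_k u x k / K%:R.
pose e (s : option 'I_K) : 'cV[R]_K := if s is Some k then delta_mx k 0 else 0.
have w0 x s : 0 <= w x s.
  case: s => [k|] /=.
    by rewrite divr_ge0 ?(ltW kap0)//; case/andP: (u01 x k).
  rewrite subr_ge0 -mulr_suml ler_pdivrMr// mul1r.
  rewrite -[in leRHS](card_ord K) -sum1_card natr_sum; apply: ler_sum => k _.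
  by case/andP: (u01 x k).
have w1 x : \sum_s w x s = 1.
  by rewrite sum_option /= subrK.
have eP s k : dotv (delta_mx k 0) (e s) = if s is Some i then (i == k)%:R else 0.
  by case: s => [i|] /=; rewrite dotvC ?dotv0l// dotv_delta mxE eqxx andbT eq_sym.
have mean x k : \sum_s w x s * dotv (delta_mx k 0) (e s) = u x k / K%:R.
  rewrite sum_option /= dotvC dotv0l mulr0 add0r (bigD1 k)//= (eP (Some k)).
  rewrite eqxx mulr1 big1 ?addr0// => i ik.
  by rewrite (eP (Some i)) (negbTE ik) mulr0.
(* The Chebyshev bound below, times [n]: [K] coordinates, each contributing [2 * B * (4 / delta ^+
   2) * (2 * K%:R / (beta * n%:R)) ^+ 2] times a variance of at most [n]. *)
pose Cc : R := 32 * B * K%:R ^+ 3 / (delta ^+ 2 * beta ^+ 2).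
have Cc0 : 0 <= Cc.
  by rewrite divr_ge0// !mulr_ge0// ?exprn_ge0 ?ler0n// ?(ltW d0) ?(ltW b0).
pose n := (Num.truncn (2 * Cc / eps)).+1.
have n0 : 0 < n%:R :> R by rewrite ltr0n.
have Ccn : Cc / n%:R <= eps / 2.
  rewrite ler_pdivrMr// mulrC -ler_pdivrMr ?divr_gt0//.
  apply: le_trans (ltW (truncnS_gt _)).
  by have -> : Cc / (eps / 2) = 2 * Cc / eps by field; rewrite gt_eqF.
(* Inverts the mean: [c k 0 / n%:R] concentrates at [u x k / K%:R], where [y c] equals
   [sin (beta * x k 0) / beta], close to [x k 0]. *)
pose y (c : 'cV[R]_K) : 'cV[R]_K :=
  \col_k ((2 * K%:R * c k 0 / n%:R - 1) / beta).
exists (fun x => walk (w x) e n (h \o y)); split.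
- apply: trigpoly_walk => -[k|] /=.
    rewrite (_ : (fun x => _) = fun x => (2 * K%:R)^-1 *
      (1 + cos (dotv (beta *: delta_mx k 0) x + - (pi / 2)))).
      by apply/trigpolyZ/trigpolyD; [exact: trigpoly_cst|exact: trigpoly_cos].
    apply/funext => x; rewrite dotvZl dotvC dotv_delta cosBpihalf /u.
    by field; rewrite gt_eqF.
  rewrite (_ : (fun x => _) = fun x => 1 + \sum_k (- (2 * K%:R)^-1) *
      (1 + cos (dotv (beta *: delta_mx k 0) x + - (pi / 2)))).
    apply: trigpolyD; first exact: trigpoly_cst.
    apply: trigpoly_sum => k.
    by apply/trigpolyZ/trigpolyD; [exact: trigpoly_cst|exact: trigpoly_cos].
  apply/funext => x; rewrite -sumrN; congr (_ + _); apply: eq_bigr => k _.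
  rewrite dotvZl dotvC dotv_delta cosBpihalf /u.
  by field; rewrite gt_eqF.
- by move=> x; apply: walk_norm_le => // c; exact: hB.
move=> x xM.
have yE c k : y c k 0 - sin (beta * x k 0) / beta =
    2 * K%:R / (beta * n%:R) * (dotv (delta_mx k 0) c - n%:R * (u x k / K%:R)).
  rewrite mxE dotvC dotv_delta /u; field.
  by rewrite !gt_eqF.
have cf0 : 0 <= 2 * B * (4 / delta ^+ 2) * (2 * K%:R / (beta * n%:R)) ^+ 2.
  by apply: mulr_ge0; rewrite ?sqr_ge0// !mulr_ge0// invr_ge0 sqr_ge0.
rewrite -[h x](walk_cst e (w1 x) n) -walkB.
apply: le_trans (le_walk_norm _ (w0 x) _ _) _.
apply: (@le_trans _ _ (walk (w x) e n (fun c => eps / 2 + \sum_k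
   (2 * B * (4 / delta ^+ 2) * (2 * K%:R / (beta * n%:R)) ^+ 2) *
   (dotv (delta_mx k 0) c - n%:R * (u x k / K%:R)) ^+ 2))).
  apply: le_walk => [s|c]; first exact: w0.
  have pos k : 0 <= 2 * B * (4 / delta ^+ 2) * (2 * K%:R / (beta * n%:R)) ^+ 2 *
      (dotv (delta_mx k 0) c - n%:R * (u x k / K%:R)) ^+ 2.
    by rewrite mulr_ge0// sqr_ge0.
  (* If some coordinate of the node is off by more than [delta / 2], its square term alone exceeds
     [2 * B]. Otherwise the node is within [delta / 2 + delta / 2] of [x]. *)
  have [/existsP[k kP]|/existsPn near] :=
      boolP [exists k, delta / 2 < `|y c k 0 - sin (beta * x k 0) / beta|].
    apply: (@le_trans _ _ (2 * B)).
      apply: le_trans (ler_normB _ _) _; rewrite mulrDl mul1r.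
      by apply: lerD; exact: hB.
    set Z := y c k 0 - _ in kP.
    rewrite (bigD1 k)//=.
    have -> : 2 * B * (4 / delta ^+ 2) * (2 * K%:R / (beta * n%:R)) ^+ 2 *
        (dotv (delta_mx k 0) c - n%:R * (u x k / K%:R)) ^+ 2 =
        2 * B * (4 / delta ^+ 2 * Z ^+ 2).
      by rewrite /Z yE exprMn; ring.
    have Z1 : 1 <= 4 / delta ^+ 2 * Z ^+ 2.
      rewrite mulrAC ler_pdivlMr ?exprn_gt0// mul1r -[Z ^+ 2]real_normK ?num_real//.
      have : (delta / 2) ^+ 2 <= `|Z| ^+ 2.
        by rewrite lerXn2r ?nnegrE ?divr_ge0 ?(ltW d0) ?(ltW kP).
      lra.
    have := ler_peMr (mulr_ge0 (ler0n R 2) B0) Z1.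
    have : 0 <= \sum_(i < K | i != k) 2 * B * (4 / delta ^+ 2) *
        (2 * K%:R / (beta * n%:R)) ^+ 2 *
        (dotv (delta_mx i 0) c - n%:R * (u x i / K%:R)) ^+ 2.
      by apply: sumr_ge0 => i _; exact: pos.
    lra.
  apply: (@le_trans _ _ (eps / 2)).
    apply: hdelta => // k.
    have := near k; rewrite -leNgt => h1; have h2 := hbeta _ (xM k).
    have := ler_normD (x k 0 - sin (beta * x k 0) / beta)
      (sin (beta * x k 0) / beta - y c k 0).
    rewrite addrA subrK [X in _ <= X + _]distrC [X in _ <= _ + X]distrC; lra.
  by rewrite lerDl sumr_ge0.
rewrite walkD walk_cst// walk_sum.
rewrite [leRHS](_ : eps = eps / 2 + eps / 2); last by field.
rewrite lerD2l; apply: le_trans Ccn.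
apply: (@le_trans _ _ (\sum_(k < K)
   (2 * B * (4 / delta ^+ 2) * (2 * K%:R / (beta * n%:R)) ^+ 2) * n%:R)).
  apply: ler_sum => k _; rewrite walkZ ler_wpM2l//.
  rewrite -mean; apply: walk_coord_variance => // s.
  by rewrite eP; case: s => [i|]; rewrite ?lexx ?ler01//; case: eqP; rewrite ?lexx ler01.
rewrite sumr_const card_ord -mulr_natl /Cc le_eqVlt; apply/orP; left; apply/eqP.
by field; rewrite !gt_eqF.
Qed.

End TrigonometricPolynomials.

(** * Cosine transform of the normal law *)

Lemma bounded_integrable {R : realType} d (T : measurableType d)
    (P : probability T R) (h : T -> R) (B : R) : measurable_fun setT h ->
  (forall x, `|h x| <= B) -> P.-integrable setT (EFin \o h).
Proof.
move=> mh hB.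
apply: (le_integrable measurableT _ _ (finite_measure_integrable_cst P B measurableT)).
  exact/measurable_EFinP.
by move=> x _ /=; rewrite lee_fin (le_trans (hB x))// ler_norm.
Qed.

Section NormalCos.
Context {R : realType}.
Variable s : R.
Hypothesis s0 : s != 0.
Local Notation mu := (@lebesgue_measure R).
Local Notation p := (normal_pdf 0 s).

Lemma normal_pdf0E x : p x = normal_peak s * expR (- (x ^+ 2 / (s ^+ 2 *+ 2))).
Proof. by rewrite normal_pdfE// /normal_fun subr0 mulNr. Qed.

Lemma is_derive_normal_pdf (x : R) : is_derive x 1 p (- (x / s ^+ 2) * p x).
Proof.
rewrite (_ : p = fun x =>
    normal_peak s * expR (- (x ^+ 2 / (s ^+ 2 *+ 2)))); last first.
  by apply/funext => y; exact: normal_pdf0E.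
apply: is_derive_eq; rewrite /GRing.scale /=.
by field.
Qed.

(** With [y = x / (2 * s)] this is [|y| <= expR (y ^+ 2)]. The wider density gives both
    integrability of the first moment and decay of [p]. *)
Lemma normal_pdf_moment_bound : exists2 c : R, 0 <= c & forall x,
  `|x| * p x <= c * normal_pdf 0 (s * Num.sqrt 2) x.
Proof.
have q0 : s * Num.sqrt 2 != 0.
  by rewrite mulf_neq0// gt_eqF// sqrtr_gt0.
have peak0 := normal_peak_gt0 s0; have peakq := normal_peak_gt0 q0.
exists (2 * `|s| * normal_peak s / normal_peak (s * Num.sqrt 2)).
  by rewrite divr_ge0 ?mulr_ge0 ?(ltW peak0) ?(ltW peakq).
move=> x; rewrite normal_pdf0E normal_pdfE// /normal_fun subr0 mulNr.
rewrite exprMn sqr_sqrtr//.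
set y := x / (2 * s).
have -> : x ^+ 2 / (s ^+ 2 *+ 2) = y ^+ 2 + y ^+ 2 by rewrite /y; field.
have -> : x ^+ 2 / (s ^+ 2 * 2 *+ 2) = y ^+ 2 by rewrite /y; field.
have -> : `|x| = 2 * `|s| * `|y|.
  rewrite /y normf_div normrM (ger0_norm (ler0n R 2)); field.
  by rewrite normr_eq0.
rewrite [leRHS](_ : _ = 2 * `|s| * (normal_peak s * expR (- y ^+ 2))); last first.
  by field; rewrite gt_eqF.
rewrite -mulrA ler_wpM2l ?mulr_ge0// mulrCA ler_wpM2l ?(ltW peak0)//.
rewrite opprD expRD mulrA ler_piMl ?expR_ge0// expRN.
rewrite ler_pdivrMr ?expR_gt0// mul1r.
have h1 := expR_ge1Dx (y ^+ 2); have h2 := sqr_ge0 (`|y| - 1).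
have h3 : `|y| ^+ 2 = y ^+ 2 by rewrite real_normK// num_real.
have h4 := sqr_ge0 y.
by apply: le_trans h1; move: h2; rewrite sqrrB h3; lra.
Qed.

Lemma integrable_normal_moment :
  mu.-integrable setT (EFin \o (fun x => `|x| * p x)).
Proof.
have [c c0 hc] := normal_pdf_moment_bound.
have ig : mu.-integrable setT
    (EFin \o (fun x => c * normal_pdf 0 (s * Num.sqrt 2) x)).
  exact: (integrableZl measurableT c (integrable_normal_pdf 0 (s * Num.sqrt 2))).
apply: (le_integrable measurableT _ _ ig).
  apply/measurable_EFinP/measurable_funM; first exact: normr_measurable.
  exact: measurable_normal_pdf.
move=> x _; rewrite /= lee_fin ger0_norm ?mulr_ge0 ?normal_pdf_ge0//.
by rewrite [leRHS]ger0_norm ?hc// mulr_ge0// normal_pdf_ge0.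
Qed.

Lemma normal_pdf_cvg0 : p n%:R @[n --> \oo] --> (0 : R).
Proof.
have [c c0 hc] := normal_pdf_moment_bound.
have q0 : s * Num.sqrt 2 != 0.
  by rewrite mulf_neq0// gt_eqF// sqrtr_gt0.
pose c1 := c * normal_peak (s * Num.sqrt 2).
have hp x : `|x| * p x <= c1.
  by apply: le_trans (hc x) _; rewrite ler_wpM2l// normal_pdf_ub.
apply: (@squeeze_cvgr _ _ _ _ (cst 0) (fun n => c1 * n%:R^-1)); last 2 first.
- exact: cvg_cst.
- rewrite -(mulr0 c1); apply: cvgMr.
  by apply/gtr0_cvgV0; [near=> n; rewrite ltr0n; near: n; exact: nbhs_infty_gt
    |exact: cvgr_idn].
near=> n; rewrite normal_pdf_ge0 /= ler_pdivlMr; last first.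
  by rewrite ltr0n; near: n; exact: nbhs_infty_gt.
by rewrite mulrC; have := hp n%:R; rewrite ger0_norm.
Unshelve. all: by end_near. Qed.

Let F b t : R := \int[mu]_x (p x * cos (t * x + b)).

Let integrable_bounded (h : R -> R) : measurable_fun setT h ->
  (forall x, `|h x| <= 1) -> mu.-integrable setT (EFin \o (fun x => p x * h x)).
Proof.
move=> mh h1.
apply: (@le_integrable _ _ _ mu setT measurableT _ (fun x => (p x)%:E)) => //.
- by apply/measurable_EFinP/measurable_funM => //; exact: measurable_normal_pdf.
- move=> x _ /=; rewrite lee_fin normrM ler_piMr//.
- exact: integrable_normal_pdf.
Qed.

Let integrable_moment_bounded (h : R -> R) : measurable_fun setT h ->
  (forall x, `|h x| <= 1) -> mu.-integrable setT (EFin \o (fun x => x * p x * h x)).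
Proof.
move=> mh h1; apply: (le_integrable measurableT _ _ integrable_normal_moment) => //.
- apply/measurable_EFinP/measurable_funM => //; apply/measurable_funM => //.
  exact: measurable_normal_pdf.
- move=> x _ /=; rewrite lee_fin [X in _ <= X]normrM normr_id !normrM.
  by rewrite ler_piMr ?mulr_ge0.
Qed.

Let cos_norm_le1 (x : R) : `|cos x| <= 1.
Proof. by rewrite ler_norml cos_geN1 cos_le1. Qed.

Let sin_norm_le1 (x : R) : `|sin x| <= 1.
Proof. by rewrite ler_norml sin_geN1 sin_le1. Qed.

Let measurable_cos_affine (t b : R) : measurable_fun setT (fun x : R => cos (t * x + b)).
Proof.
apply: measurableT_comp; first by apply: continuous_measurable_fun => y; exact: continuous_cos.
by apply: measurable_funD => //; exact: measurable_funM.
Qed.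

Let measurable_sin_affine (t b : R) : measurable_fun setT (fun x : R => sin (t * x + b)).
Proof.
apply: measurableT_comp; first by apply: continuous_measurable_fun => y; exact: continuous_sin.
by apply: measurable_funD => //; exact: measurable_funM.
Qed.

Let is_derive_F b (t : R) :
  is_derive t 1 (F b) (- \int[mu]_x (x * p x * sin (t * x + b))).
Proof.
pose f (t x : R) := p x * cos (t * x + b).
have df (t0 x : R) : is_derive t0 1 (f ^~ x) (- (x * p x * sin (t0 * x + b))).
  rewrite /f; apply: is_derive_eq; rewrite /GRing.scale /=; ring.
have d1f (t0 x : R) : partial1of2 f t0 x = - (x * p x * sin (t0 * x + b)).
  by rewrite partial1of2E; have /@derive_val := df t0 x.
have tI : `]t - 1, t + 1[%classic t by rewrite /= in_itv /=; lra.
have intf x : `]t - 1, t + 1[%classic x -> mu.-integrable setT (EFin \o f x).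
  by move=> _; apply: integrable_bounded.
have derf (x y : R) : `]t - 1, t + 1[%classic x -> [set: R] y -> derivable (f ^~ y) x 1.
  by move=> _ _; have [] := df x y.
have G0 (y : R) : 0 <= `|y| * p y by rewrite mulr_ge0// normal_pdf_ge0.
have Gub x y : `]t - 1, t + 1[%classic x -> [set: R] y -> `|partial1of2 f x y| <= `|y| * p y.
  move=> _ _; rewrite d1f normrN !normrM (ger0_norm (normal_pdf_ge0 _ _ _)).
  by rewrite ler_piMr// mulr_ge0// normal_pdf_ge0.
apply: DeriveDef.
  exact: (derivable_under_integral measurableT tI intf derf G0 integrable_normal_moment Gub).
rewrite -derive1E.
rewrite (differentiation_under_integral measurableT tI intf derf G0 integrable_normal_moment Gub).
rewrite -[RHS]mulN1r -RintegralZl//; last exact: integrable_moment_bounded.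
by apply: eq_Rintegral => x _; rewrite d1f mulN1r.
Qed.

(** Integration by parts: the integrand is the derivative of [p x * sin (t * x + b)], which vanishes
    at infinity. *)
Let integral_derivative_eq0 (t b : R) :
  \int[mu]_x (t * (p x * cos (t * x + b)) - (s ^+ 2)^-1 * (x * p x * sin (t * x + b)))
  = 0.
Proof.
set k := fun x => _.
pose H x := p x * sin (t * x + b).
have dH (x : R) : is_derive x 1 H (k x).
  have := is_derive_normal_pdf x; rewrite /H /k => dp.
  by apply: is_derive_eq; rewrite /GRing.scale /=; ring.
have ik : mu.-integrable setT (EFin \o k).
  rewrite (_ : EFin \o k = fun x => ((t * (p x * cos (t * x + b)))%:E
    - ((s ^+ 2)^-1 * (x * p x * sin (t * x + b)))%:E)%E); last exact/funext.
  apply: integrableB => //; first exact: (integrableZl measurableT t (integrable_bounded _ _)).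
  exact: (integrableZl measurableT _ (integrable_moment_bounded _ _)).
have cH x : {for x, continuous H}.
  by apply/differentiable_continuous/derivable1_diffP; have [] := dH x.
have ck : continuous k.
  have cp x : {for x, continuous p} by exact: continuous_normal_pdf.
  have caff x : {for x, continuous (fun y : R => t * y + b)}.
    by apply: cvgD; [apply: cvgMr; exact: cvg_id|exact: cvg_cst].
  move=> x; apply: cvgB; apply: cvgMr; apply: cvgM.
  - exact: cp.
  - by apply: (cvg_comp _ _ (caff x)); exact: continuous_cos.
  - by apply: cvgM; [exact: cvg_id|exact: cp].
  - by apply: (cvg_comp _ _ (caff x)); exact: continuous_sin.
have FTC n : (\int[mu]_(x in `[(- n.+1%:R)%R, (n.+1%:R)%R]) (k x)%:E =
    (H n.+1%:R)%:E - (H (- n.+1%:R))%:E)%E.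
  rewrite (@continuous_FTC2 _ k H)//.
  - have := ltr0Sn R n; lra.
  - exact: continuous_subspaceT.
  - split; first by move=> x _; have [] := dH x.
    + exact/cvg_at_right_filter/cH.
    + exact/cvg_at_left_filter/cH.
  - by move=> x _; rewrite derive1E; have /@derive_val := dH x.
(* The index [n.+1] keeps the intervals nondegenerate, as the fundamental theorem of calculus
   requires; dominated convergence then passes to the line. *)
pose D n : set R := [set` `[- n.+1%:R, n.+1%:R]].
pose kn n := (EFin \o k) \_ (D n).
have mD n : measurable (D n) by exact: measurable_itv.
have kD n : (\int[mu]_x kn n x = (H n.+1%:R)%:E - (H (- n.+1%:R))%:E)%E.
  by rewrite -FTC [RHS]integral_mkcond; apply: eq_integral => x _.
have [] := @dominated_convergence _ _ _ mu setT measurableT kn (EFin \o k)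
  (abse \o (EFin \o k)).
- move=> n; apply/(measurable_restrictT _ (mD n)).
  by apply: measurable_funTS; exact: measurable_int ik.
- exact: measurable_int ik.
- apply: aeW => x _; apply: cvg_near_cst; near=> n.
  rewrite /kn patchE ifT// inE /D /= in_itv /= -ler_norml.
  near: n; exists (Num.truncn `|x|) => // n /= nx.
  by apply: le_trans (ltW (truncnS_gt _)) _; rewrite ler_nat.
- exact: integrable_abse.
- by apply: aeW => x n _; rewrite /kn patchE; case: ifP => //= _; rewrite normr0 lee_fin.
move=> _ _ h1.
have Hc : (H n.+1%:R - H (- n.+1%:R)) @[n --> \oo] --> (0 : R).
  apply: norm_cvg0; apply: (@squeeze_cvgr _ _ _ _ (cst 0) (fun n => 2 * p n.+1%:R)).
  - apply: nearW => n; rewrite normr_ge0 /=; apply: le_trans (ler_normB _ _) _.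
    have pN : p (- n.+1%:R) = p n.+1%:R by rewrite !normal_pdf0E sqrrN.
    rewrite /H !normrM pN (ger0_norm (normal_pdf_ge0 _ _ _)) mulrDl mul1r.
    by apply: lerD; rewrite ler_piMr// normal_pdf_ge0.
  - exact: cvg_cst.
  - rewrite -[X in _ --> X](mulr0 (2 : R)); apply: cvgMr.
    have := normal_pdf_cvg0; rewrite -(cvg_shiftS (fun n => p n%:R)); exact.
have {}h1 : (\int[mu]_x kn n x)%E @[n --> \oo] --> (\int[mu]_x (k x)%:E)%E by exact: h1.
have h2 : (\int[mu]_x kn n x)%E @[n --> \oo] --> (0%R)%:E.
  under eq_fun do rewrite kD -EFinB.
  by apply: cvg_EFin => //; exact: nearW.
by rewrite /Rintegral (cvg_unique _ h1 h2).
Unshelve. all: by end_near. Qed.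

(* The cosine transform solves [F' = - s ^ 2 * t * F] in [t]. *)
Lemma integral_normal_pdf_cos (b t : R) :
  \int[mu]_x (p x * cos (t * x + b)) = expR (- (s ^+ 2 * t ^+ 2 / 2)) * cos b.
Proof.
(* The integrating factor makes [H] constant, with value [cos b] at 0. *)
pose H (t : R) : R := expR (s ^+ 2 * t ^+ 2 / 2) * F b t.
have ode (r : R) : \int[mu]_x (x * p x * sin (r * x + b)) = s ^+ 2 * r * F b r.
  have := integral_derivative_eq0 r b; rewrite RintegralB//; first last.
  - exact: (integrableZl measurableT _ (integrable_moment_bounded _ _)).
  - exact: (integrableZl measurableT _ (integrable_bounded _ _)).
  rewrite !RintegralZl//; [|exact: integrable_moment_bounded|exact: integrable_bounded].
  rewrite -/(F b r) => /eqP; rewrite subr_eq0 => /eqP E.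
  have s20 : s ^+ 2 != 0 by rewrite expf_neq0.
  apply: (mulfI (invr_neq0 s20)); rewrite -E; by field.
have dH (r : R) : is_derive r 1 H 0.
  have dF := is_derive_F b r; rewrite /H.
  apply: is_derive_eq; rewrite /GRing.scale /= ode; by field.
have := is_derive_0_is_cst t 0 dH; rewrite /H.
have -> : F b 0 = cos b.
  rewrite /F; under eq_Rintegral do rewrite mul0r add0r mulrC.
  rewrite RintegralZl//; last exact: integrable_normal_pdf.
  by rewrite /Rintegral integral_normal_pdf mulr1.
rewrite expr0n /= mulr0 mul0r expR0 mul1r expRN -/(F b t) => <-.
by rewrite mulKf// gt_eqF// expR_gt0.
Qed.

Lemma integral_normal_prob_cos (b : R) :
  (\int[normal_prob 0 s]_x (cos (x + b))%:E = (expR (- (s ^+ 2 / 2)) * cos b)%:E)%E.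
Proof.
have mc : measurable_fun setT (fun x : R => (cos (x + b))%:E).
  apply/measurable_EFinP; rewrite (_ : (fun x => _) = fun x => cos (1 * x + b)) //.
  by apply/funext => x; rewrite mul1r.
have ic : (normal_prob 0 s).-integrable setT (fun x : R => (cos (x + b))%:E).
  by apply: (@bounded_integrable _ _ _ _ _ 1) => //; exact/measurable_EFinP.
rewrite -(Radon_Nikodym_change_of_variables (normal_prob_dominates 0 s))//=.
transitivity (\int[mu]_x (p x * cos (1 * x + b))%:E)%E; last first.
  have := integral_normal_pdf_cos b 1; rewrite expr1n mulr1 => <-.
  rewrite /Rintegral fineK//.
  apply: integrable_fin_num => //; exact: integrable_bounded.
have pdom := normal_prob_dominates (0 : R) s.
have mp : measurable_fun setT (fun x => (p x)%:E).
  by apply/measurable_EFinP; exact: measurable_normal_pdf.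
transitivity (\int[mu]_x ((cos (x + b))%:E * (p x)%:E))%E; last first.
  by apply: eq_integral => x _; rewrite mul1r mulrC EFinM.
apply: ae_eq_integral => //.
- exact: emeasurable_funM.
- exact: emeasurable_funM.
- apply: ae_eqe_mul2l => /=; rewrite Radon_NikodymE//=.
  case: cid => /= h [h1 h2 h3]; apply: integral_ae_eq => //= E _ mE.
  by rewrite -h3.
Qed.

End NormalCos.

Lemma integral_normal_law_cos {R : realType} d (T : measurableType d)
    (P : probability T R) (X : T -> R) (v b : R) : 0 <= v ->
  measurable_fun setT X ->
  (forall A, measurable A -> P [set x | A (X x)] = normal_law 0 v A) ->
  (\int[P]_x (cos (X x + b))%:E = (expR (- (v / 2)) * cos b)%:E)%E.
Proof.
move=> v0 mX law.
have mcb : measurable_fun setT (fun x : R => cos (x + b)).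
  apply: measurableT_comp; last exact: measurable_funD.
  by apply: continuous_measurable_fun => y; exact: continuous_cos.
have mc : measurable_fun setT (fun x : R => (cos (x + b))%:E).
  exact/measurable_EFinP.
have cb (x : R) : `|cos x| <= 1 by rewrite ler_norml cos_geN1 cos_le1.
pose X' : T -> measurableTypeR R := X.
have mX' : measurable_fun setT X' by exact: mX.
transitivity (\int[pushforward P X']_x (cos (x + b))%:E)%E.
  rewrite (integral_pushforward mX')//.
  apply: (@bounded_integrable _ _ _ _ _ 1) => //.
  exact: (measurableT_comp mcb mX).
have [v_0|v_n0] := eqVneq v 0.
  transitivity (\int[dirac (0%R : measurableTypeR R)]_x (cos (x + b))%:E)%E.
    apply: eq_measure_integral => A mA _; rewrite [LHS]law//.
    by rewrite /normal_law v_0 eqxx.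
  by rewrite integral_dirac// diracT mul1e v_0 mul0r oppr0 expR0 mul1r add0r.
transitivity (\int[normal_prob 0 (Num.sqrt v)]_x (cos (x + b))%:E)%E.
  apply: eq_measure_integral => A mA _; rewrite [LHS]law//.
  by rewrite /normal_law (negbTE v_n0).
rewrite integral_normal_prob_cos ?sqr_sqrtr// gt_eqF// sqrtr_gt0.
by rewrite lt_neqAle eq_sym v_n0.
Qed.

(** * Central limit theorem *)

Lemma cvg_dist_le {R : realType} (u b : nat -> R) (l : R) :
  (\forall n \near \oo, `|u n - l| <= b n) -> b n @[n --> \oo] --> (0 : R) ->
  u n @[n --> \oo] --> l.
Proof.
move=> ub /cvgrPdist_le b0; apply/cvgrPdist_le => e e0.
near=> n; rewrite distrC; apply: (@le_trans _ _ (b n)); first by near: n.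
by apply: le_trans (ler_norm _) _; rewrite -normrN -[- b n]sub0r; near: n; exact: b0.
Unshelve. all: by end_near. Qed.

Lemma sqrtr_inv_cvg0 {R : realType} : (Num.sqrt n%:R : R)^-1 @[n --> \oo] --> (0 : R).
Proof.
apply/cvgrPdist_le => /= e e0; near=> n.
rewrite sub0r normrN ger0_norm ?invr_ge0 ?sqrtr_ge0//.
rewrite -[leRHS]invrK lef_pV2 ?posrE ?invr_gt0// ?sqrtr_gt0 ?ltr0n; last first.
  by near: n; exact: nbhs_infty_gt.
rewrite -[leLHS]ger0_norm ?invr_ge0 ?(ltW e0)// -sqrtr_sqr ler_wsqrtr//.
by near: n; exact: nbhs_infty_ger.
Unshelve. all: by end_near. Qed.

Section CentralLimit.
Context {R : realType} {K : nat}.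
Variable p : 'cV[R]_K.
Hypothesis hp : simplex p.

Local Notation step := (fun k : 'I_K => delta_mx k 0 : 'cV[R]_K).
Local Notation mwalk := (walk (fun k => p k 0) step).

Definition normalized_count (n : nat) (c : 'cV[R]_K) : 'cV[R]_K :=
  (Num.sqrt n%:R)^-1 *: (c - n%:R *: p).

Let p0 k : 0 <= p k 0. Proof. by case: hp. Qed.

Let p1 : \sum_k p k 0 = 1.
Proof. by case: hp => _ <-; apply: eq_bigr => k _; rewrite mxE mul1r. Qed.

Let meanE a : \sum_k p k 0 * dotv a (step k) = dotv a p.
Proof. by apply: eq_bigr => k _; rewrite dotv_delta mulrC. Qed.

(** Both sides are the mean of the squares minus the squared mean for one draw; the right side shows
    the form to be nonnegative and is what the walk produces. *)
Lemma multinomial_cov_variance a : dotv a (multinomial_cov p *m a) =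
  \sum_k p k 0 * (dotv a (step k) - dotv a p) ^+ 2.
Proof.
set m := dotv a p.
have mE : m = \sum_k p k 0 * a k 0 by rewrite /m dotvC.
have -> : dotv a (multinomial_cov p *m a) =
    \sum_k (p k 0 * a k 0 ^+ 2 - m * (p k 0 * a k 0)).
  apply: eq_bigr => i _.
  have -> : (multinomial_cov p *m a) i 0 = p i 0 * a i 0 - p i 0 * m.
    rewrite mxE mE mulr_sumr (bigD1 i)//= [X in _ = _ - X](bigD1 i)//= mxE eqxx.
    rewrite (eq_bigr (fun k => - (p i 0 * (p k 0 * a k 0)))) => [|k ki].
      by rewrite sumrN; ring.
    by rewrite mxE eq_sym (negbTE ki) mulNr mulrA.
  by ring.
rewrite [RHS](eq_bigr (fun k => p k 0 * a k 0 ^+ 2 - m * (p k 0 * a k 0)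
   + m * (m * p k 0 - p k 0 * a k 0))).
  rewrite [RHS]big_split /= [X in _ = _ + X](_ : _ = 0) ?addr0//.
  by rewrite -mulr_sumr sumrB -mulr_sumr p1 -mE mulr1 subrr mulr0.
by move=> k _; rewrite dotv_delta; ring.
Qed.

Lemma normalized_countE a n c : dotv a (normalized_count n c) =
  (Num.sqrt n%:R)^-1 * (dotv a c - n%:R * \sum_k p k 0 * dotv a (step k)).
Proof. by rewrite meanE dotvZr dotvBr dotvZr. Qed.

(** Since [q] is an exponential, [q ^+ n] is exactly the limit factor, and the error
    [n%:R * (c * t ^+ 3)] reduces to [c * t]. *)
Lemma walk_cos_cvg (a : 'cV[R]_K) (b : R) :
  mwalk n (fun c => cos (dotv a (normalized_count n c) + b)) @[n --> \oo] -->
  expR (- (dotv a (multinomial_cov p *m a) / 2)) * cos b.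
Proof.
rewrite multinomial_cov_variance; set v := \sum_k _.
have xi0 : \sum_k p k 0 * (dotv a (step k) - dotv a p) = 0.
  rewrite (eq_bigr (fun k => p k 0 * dotv a (step k) - p k 0 * dotv a p)).
    by rewrite sumrB meanE -mulr_suml p1 mul1r subrr.
  by move=> k _; rewrite mulrBr.
have [c c0 hc] := step_cos p0 p1 xi0.
apply: (@cvg_dist_le _ _ (fun n => c * (Num.sqrt n%:R)^-1)).
- near=> n.
  have n0 : 0 < n%:R :> R by rewrite ltr0n; near: n; exact: nbhs_infty_gt.
  have n1 : 1 <= n%:R :> R by rewrite ler1n; near: n; exact: nbhs_infty_ge.
  set t := (Num.sqrt n%:R)^-1.
  have t0 : 0 < t by rewrite invr_gt0 sqrtr_gt0.
  have nt : n%:R * t ^+ 2 = 1.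
    by rewrite exprVn sqr_sqrtr ?(ltW n0)// mulfV// gt_eqF.
  have t1 : t <= 1.
    by rewrite invf_le1 ?sqrtr_gt0// -[leLHS]sqrtr1 ler_wsqrtr.
  pose q := expR (- (t ^+ 2 * v / 2)).
  have q01 : 0 <= q <= 1.
    rewrite expR_ge0 /= -[leRHS]expR0 ler_expR oppr_le0 divr_ge0// mulr_ge0//.
      exact: sqr_ge0.
    by apply: sumr_ge0 => k _; rewrite mulr_ge0// sqr_ge0.
  have step1 c' : `|\sum_k p k 0 * cos (c' + t * (dotv a (step k)
      - \sum_k p k 0 * dotv a (step k))) - q * cos c'| <= c * t ^+ 3.
    by rewrite meanE; apply: hc; rewrite (ltW t0).
  have := @walk_cos _ _ _ _ step p0 p1 a n t q (c * t ^+ 3) b q01 step1.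
  have -> : q ^+ n = expR (- (v / 2)).
    rewrite -expRM_natl; congr expR.
    have -> : n%:R * - (t ^+ 2 * v / 2) = - (n%:R * t ^+ 2 * v / 2) by ring.
    by rewrite nt mul1r.
  have -> : n%:R * (c * t ^+ 3) = c * t.
    have -> : n%:R * (c * t ^+ 3) = n%:R * t ^+ 2 * (c * t) by ring.
    by rewrite nt mul1r.
  rewrite (_ : (fun x => cos (b + _)) =
    fun c => cos (dotv a (normalized_count n c) + b))//.
  by apply/funext => x; rewrite normalized_countE addrC.
- rewrite -[X in _ --> X](mulr0 c); apply: cvgMr; exact: sqrtr_inv_cvg0.
Unshelve. all: by end_near. Qed.

Lemma walk_normalized_sqr n k : (0 < n)%N ->
  mwalk n (fun c => normalized_count n c k 0 ^+ 2) <= 1.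
Proof.
move=> n0.
rewrite (_ : (fun c => _) = fun c => ((Num.sqrt n%:R)^-1) ^+ 2 *
  (dotv (delta_mx k 0) c
   - n%:R * \sum_i p i 0 * dotv (delta_mx k 0) (step i)) ^+ 2).
  rewrite walkZ exprVn sqr_sqrtr ?ler0n// mulrC ler_pdivrMr ?ltr0n// mul1r.
  apply: walk_coord_variance => // i; rewrite dotv_delta mxE andbT.
  by case: eqP; rewrite ?lexx ?ler01.
apply/funext => c; rewrite -exprMn -normalized_countE dotvC dotv_delta.
by [].
Qed.

Variables (d : measure_display) (T : measurableType d) (Q : probability T R).
Variable Z : T -> 'cV[R]_K.
Hypothesis mZ : random_vector Z.
Hypothesis cosZ : forall a b, \int[Q]_x cos (dotv a (Z x) + b) =
  expR (- (dotv a (multinomial_cov p *m a) / 2)) * cos b.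

Let measurable_dotv a : measurable_fun setT (fun x => dotv a (Z x)).
Proof. by apply: measurable_sum => k; exact: measurable_funM. Qed.

(** Measurability and a bound travel with the convergence because linearity of the integral needs
    integrable summands. *)
Lemma walk_trigpoly_cvg f : trigpoly f ->
  [/\ measurable_fun setT (f \o Z), exists B, forall x, `|f x| <= B &
    mwalk n (f \o normalized_count n) @[n --> \oo] --> \int[Q]_x f (Z x)].
Proof.
elim => [a b|c {}f _ [mf [B fB] cf]|f1 f2 _ [m1 [B1 fB1] c1] _ [m2 [B2 fB2] c2]].
- split.
  + apply: measurableT_comp.
      by apply: continuous_measurable_fun => y; exact: continuous_cos.
    exact: measurable_funD.
  + by exists 1 => x; rewrite ler_norml cos_geN1 cos_le1.
  + by rewrite cosZ; exact: walk_cos_cvg.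
- split; first exact: measurable_funM.
  + by exists (`|c| * B) => x; rewrite normrM ler_wpM2l.
  + rewrite RintegralZl//; last by apply: (@bounded_integrable _ _ _ _ _ B) => //.
    rewrite (_ : (fun n => _) = fun n => c * mwalk n (f \o normalized_count n)).
      exact: cvgMr.
    by apply/funext => n; rewrite -walkZ.
- split; first exact: measurable_funD.
  + exists (B1 + B2) => x; apply: le_trans (ler_normD _ _) _.
    exact: lerD.
  + rewrite RintegralD//; [|by apply: (@bounded_integrable _ _ _ _ _ B1) => //
      |by apply: (@bounded_integrable _ _ _ _ _ B2) => //].
    rewrite (_ : (fun n => _) = fun n => mwalk n (f1 \o normalized_count n)
      + mwalk n (f2 \o normalized_count n)); first exact: cvgD.
    by apply/funext => n; rewrite -walkD.
Qed.

Lemma multinomial_clt (h : 'cV[R]_K -> R) (B : R) : (0 < K)%N ->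
  (forall x, `|h x| <= B) -> loc_unif_continuous h ->
  measurable_fun setT (h \o Z) ->
  mwalk n (h \o normalized_count n) @[n --> \oo] --> \int[Q]_x h (Z x).
Proof.
move=> K0 hB hc mh.
have B0 : 0 <= B by apply: le_trans (hB 0).
pose approximates (j : nat) (g : 'cV[R]_K -> R) := [/\ trigpoly g,
    forall x, `|g x| <= B & forall x : 'cV[R]_K,
    (forall k, `|x k 0| <= j.+1%:R) -> `|h x - g x| <= j.+1%:R^-1].
have [f hf] : {f & forall j, approximates j (f j)}.
  by apply: boolp.choice => j; apply: trigpoly_approx => //; rewrite invr_gt0.
(* One estimate on the whole space: the first summand serves inside the cube; outside it some
   squared coordinate exceeds [j.+1], which pays for the trivial bound [2 * B]. *)
have hfx j x : `|h x - f j x| <= (1 + 2 * B * \sum_k x k 0 ^+ 2) / j.+1%:R.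
  have j1 : 1 <= j.+1%:R :> R by rewrite ler1n.
  have [_ fB fh] := hf j.
  have S0 : 0 <= \sum_k x k 0 ^+ 2 by apply: sumr_ge0 => k _; exact: sqr_ge0.
  have BS : 0 <= 2 * B * \sum_k x k 0 ^+ 2 by rewrite !mulr_ge0.
  have [/existsP[k kj]|/existsPn near] := boolP [exists k, j.+1%:R < `|x k 0|].
    rewrite ler_pdivlMr//.
    have xj : j.+1%:R <= \sum_k x k 0 ^+ 2.
      apply: (@le_trans _ _ (x k 0 ^+ 2)); last first.
        by rewrite (bigD1 k)//= lerDl; apply: sumr_ge0 => i _; exact: sqr_ge0.
      rewrite -[leRHS]real_normK ?num_real// expr2.
      apply: le_trans (ltW kj) _; rewrite ler_peMl//.
      exact: le_trans j1 (ltW kj).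
    apply: (@le_trans _ _ (2 * B * \sum_k x k 0 ^+ 2)); last by rewrite lerDr.
    apply: ler_pM => //; apply: le_trans (ler_normB _ _) _.
    by rewrite mulrDl mul1r lerD.
  apply: (@le_trans _ _ j.+1%:R^-1).
    by apply: fh => k; rewrite leNgt; exact: near.
  by rewrite ler_peMl ?invr_ge0// lerDl.
have fZ : \int[Q]_x f j (Z x) @[j --> \oo] --> \int[Q]_x h (Z x).
  have mf j : measurable_fun setT (f j \o Z).
    by have [/walk_trigpoly_cvg[]] := hf j.
  have [] := @dominated_convergence _ _ _ Q setT measurableT
    (fun j x => (f j (Z x))%:E) (fun x => (h (Z x))%:E) (fun=> B%:E).
  - by move=> j; apply/measurable_EFinP; exact: mf.
  - exact/measurable_EFinP.
  - apply: aeW => x _; apply: cvg_EFin; first exact: nearW.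
    set s := 1 + 2 * B * \sum_k Z x k 0 ^+ 2.
    apply: (@cvg_dist_le _ _ (fun n => s * n.+1%:R^-1)).
    + by apply: nearW => n; rewrite distrC; exact: hfx.
    + by rewrite -[X in _ --> X](mulr0 s); apply: cvgMr; exact: cvg_harmonic.
  - exact: (finite_measure_integrable_cst Q B).
  - by apply: aeW => x j _; rewrite lee_fin; have [_ + _] := hf j; apply.
  move=> _ _ H; apply: fine_cvg; move: H; rewrite fineK//.
  by apply: integrable_fin_num => //; by apply: (@bounded_integrable _ _ _ _ _ B) => //.
apply/cvgrPdist_le => /= eps eps0.
have e30 : 0 < eps / 3 by rewrite divr_gt0.
(* Bounds the walk expectation of the numerator in [hfx] uniformly in [n], as each normalised
   coordinate has second moment at most 1. *)
pose s : R := 1 + 2 * B * K%:R.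
have /cvgrPdist_le/(_ _ e30) fZ1 := fZ.
have sj : s * n.+1%:R^-1 @[n --> \oo] --> (0 : R).
  by rewrite -[X in _ --> X](mulr0 s); apply: cvgMr; exact: cvg_harmonic.
have /cvgrPdist_le/(_ _ e30) sj1 := sj.
have [j [hj1 hj2]] : exists j, `|\int[Q]_x h (Z x) - \int[Q]_x f j (Z x)| <= eps / 3
    /\ `|0 - s * j.+1%:R^-1| <= eps / 3.
  have [j _ /(_ j (leqnn j)) hj] := filterI fZ1 sj1.
  by exists j.
have [tfj fB _] := hf j.
have [_ _ /cvgrPdist_le/(_ _ e30) wj] := walk_trigpoly_cvg tfj.
near=> n.
have n0 : (0 < n)%N by near: n; exact: nbhs_infty_gt.
have wn : `|\int[Q]_x f j (Z x) - mwalk n (f j \o normalized_count n)| <= eps / 3.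
  by near: n.
have hfn : `|mwalk n (h \o normalized_count n) - mwalk n (f j \o normalized_count n)|
    <= s * j.+1%:R^-1.
  rewrite -walkB; apply: le_trans (le_walk_norm _ p0 _ _) _.
  apply: le_trans (le_walk _ p0 _ (fun x => hfx j (normalized_count n x))) _.
  rewrite (_ : (fun x => _) = fun c => j.+1%:R^-1 *
      (1 + 2 * B * \sum_k normalized_count n c k 0 ^+ 2)); last first.
    by apply/funext => c; rewrite mulrC.
  rewrite walkZ walkD walk_cst// walkZ walk_sum mulrC ler_wpM2r ?invr_ge0//.
  rewrite lerD2l ler_wpM2l ?mulr_ge0//.
  rewrite -[in leRHS](card_ord K) -sum1_card natr_sum; apply: ler_sum => k _.
  exact: walk_normalized_sqr.
have s0 : 0 <= s * j.+1%:R^-1 by exact: le_trans hfn.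
move: hj2; rewrite sub0r normrN ger0_norm// => hj2.
move: hj1 wn (le_trans hfn hj2); rewrite !ler_norml => /andP[? ?] /andP[? ?] /andP[? ?].
by apply/andP; split; lra.
Unshelve. all: by end_near. Qed.

End CentralLimit.

(** * The multinomial law as a random walk *)

Section MultinomialLaw.
Context {R : realType} {K : nat}.
Variable p : 'cV[R]_K.
Hypothesis hp : simplex p.

Local Notation step := (fun k : 'I_K => delta_mx k 0 : 'cV[R]_K).
Local Notation mwalk := (walk (fun k => p k 0) step).

Definition count_vector (c : 'I_K -> nat) : 'cV[R]_K := \col_k (c k)%:R.

Lemma count_vector_inj (c c' : 'I_K -> nat) :
  count_vector c = count_vector c' -> c =1 c'.
Proof.
move=> E k; have /colP/(_ k) := E; rewrite !mxE => /eqP.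
by rewrite eqr_nat => /eqP.
Qed.

(** Allows a functional to be changed off the reachable points, in particular where a coordinate is
    negative. *)
Lemma eq_walk_count n (h g : 'cV[R]_K -> R) :
  (forall c : {ffun 'I_K -> nat}, (\sum_k c k)%N = n ->
    h (count_vector c) = g (count_vector c)) -> mwalk n h = mwalk n g.
Proof.
elim: n h g => [|n IH] h g hg /=.
  have := hg [ffun=> 0%N]; rewrite big1 => [|k _]; last by rewrite ffunE.
  move=> /(_ erefl); rewrite (_ : count_vector _ = 0)//.
  by apply/colP => k; rewrite !mxE ffunE.
apply: eq_bigr => k _; congr (_ * _); apply: IH => c cn.
pose c' : {ffun 'I_K -> nat} := [ffun i => (c i + (i == k))%N].
have -> : count_vector c + delta_mx k 0 = count_vector c'.
  by apply/colP => i; rewrite !mxE ffunE eqxx andbT natrD.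
apply: hg; rewrite (eq_bigr (fun i => c i + (i == k)))%N => [|i _].
  rewrite big_split /= cn -addn1; congr (_ + _)%N.
  by rewrite (bigD1 k)//= eqxx big1 ?addn0// => i /negbTE ->.
by rewrite ffunE.
Qed.

(** Conditioning on one step: the term of step [k] is [c k] times a common factor, and the [c k] add
    up to [n.+1]. *)
Lemma walk_count_pmf n (c : {ffun 'I_K -> nat}) : (\sum_k c k)%N = n ->
  mwalk n (fun x => (x == count_vector c)%:R) =
  n`!%:R / (\prod_k (c k)`!)%:R * \prod_k p k 0 ^+ c k.
Proof.
elim: n c => [|n IH] c cn /=.
  have c0 k : c k = 0%N.
    by move/eqP: cn; rewrite sum_nat_eq0 => /forallP/(_ k)/eqP.
  rewrite (_ : count_vector c = 0); last by apply/colP => k; rewrite !mxE c0.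
  rewrite eqxx big1 => [|k _]; last by rewrite c0.
  by rewrite invr1 mulr1 mul1r big1// => k _; rewrite c0.
have key k : p k 0 * mwalk n (fun x => (x + delta_mx k 0 == count_vector c)%:R) =
    (c k)%:R * (n`!%:R / (\prod_k (c k)`!)%:R * \prod_k p k 0 ^+ c k).
  have [ck|ck] := posnP (c k).
    rewrite ck mul0r (@eq_walk_count _ _ (fun=> 0)) => [|c' _].
      by rewrite (_ : (fun=> 0) = fun x => 0 * 0 :> R) ?walkZ ?mul0r ?mulr0//;
        apply/funext => ?; rewrite mul0r.
    case: eqP => // /colP/(_ k)/eqP; rewrite !mxE ck !eqxx /= natr1.
    by rewrite pnatr_eq0.
  pose c' : {ffun 'I_K -> nat} := [ffun i => (c i - (i == k))%N].
  have cE i : c i = (c' i + (i == k))%N.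
    by rewrite ffunE; case: eqP => [->|_]; rewrite ?subnK// subn0 addn0.
  rewrite [X in walk _ _ _ X](_ : _ = fun x => (x == count_vector c')%:R); last first.
    apply/funext => x; congr (nat_of_bool _)%:R.
    have -> : count_vector c = count_vector c' + delta_mx k 0.
      by apply/colP => i; rewrite !mxE cE eqxx andbT natrD.
    by rewrite (inj_eq (addIr _)).
  rewrite IH; last first.
    have : (\sum_i c i = \sum_i c' i + 1)%N.
      rewrite (eq_bigr _ (fun i _ => cE i)) big_split /=; congr (_ + _)%N.
      by rewrite (bigD1 k)//= eqxx big1 ?addn0// => i /negbTE ->.
    by rewrite cn addn1 => -[].
  have ck' : c k = (c' k).+1 by rewrite cE eqxx addn1.
  have ci i : i != k -> c i = c' i by move=> /negbTE ik; rewrite cE ik addn0.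
  rewrite [X in X%:R^-1](bigD1 k)//= [in RHS](bigD1 k)//=.
  rewrite [X in _ = _ * (_ / (_ * X)%:R * _)](eq_bigr (fun i => (c' i)`!)) => [|i /ci ->//].
  rewrite [X in _ * (_ * X) = _](bigD1 k)//= [X in _ = _ * (_ * X)](bigD1 k)//=.
  rewrite [X in _ = _ * (_ * (_ * X))](eq_bigr (fun i => p i 0 ^+ c' i)) => [|i /ci ->//].
  rewrite ck' factS exprS !natrM.
  have fk : (c' k)`!%:R != 0 :> R by rewrite pnatr_eq0 -lt0n fact_gt0.
  have fi : (\prod_(i < K | i != k) (c' i)`!)%:R != 0 :> R.
    by rewrite pnatr_eq0 -lt0n prodn_cond_gt0// => i _; exact: fact_gt0.
  have sk : (c' k).+1%:R != 0 :> R by rewrite pnatr_eq0.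
  by field; rewrite fk fi /= addrC natr1 sk.
rewrite (eq_bigr _ (fun k _ => key k)) -mulr_suml -natr_sum cn factS natrM.
by ring.
Qed.

(** The law prescribes only the masses of the count vectors. These add up to 1, the walk expectation
    of the constant 1, so the remaining event is null and a bounded [h] may be replaced by its
    restriction to the counts. *)
Lemma multinomial_law_expectation d (T : measurableType d) (P : probability T R)
    n (X : T -> 'cV[R]_K) (h : 'cV[R]_K -> R) (B : R) :
  multinomial_law P n p X -> measurable_fun setT (h \o X) ->
  (forall x, `|h x| <= B) -> \int[P]_x h (X x) = mwalk n h.
Proof.
move=> [mX lawX] mh hB.
have [p0 p1] : (forall k, 0 <= p k 0) /\ \sum_k p k 0 = 1.
  by case: hp => ? <-; split => //; apply: eq_bigr => k _; rewrite mxE mul1r.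
pose A := [seq c : {ffun 'I_K -> 'I_n.+1} <- enum {: {ffun 'I_K -> 'I_n.+1}} |
  (\sum_k c k == n)%N].
have uA : uniq A by rewrite filter_uniq// enum_uniq.
pose cv (c : {ffun 'I_K -> 'I_n.+1}) := count_vector (fun k => c k).
pose simple (g : 'cV[R]_K -> R) x := \sum_(c <- A) g (cv c) * (x == cv c)%:R.
have simpleE g x : (exists2 c, c \in A & x = cv c) -> simple g x = g x.
  move=> [c cA ->]; rewrite /simple (bigD1_seq c)//= eqxx mulr1 big1 ?addr0//.
  move=> c' /negbTE cc'; case: eqP => [/count_vector_inj E|_]; last by rewrite mulr0.
  by move: cc'; rewrite (_ : c' = c) ?eqxx//; apply/ffunP => k; apply/val_inj/esym/E.
have simple0 g x : ~ (exists2 c, c \in A & x = cv c) -> simple g x = 0.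
  move=> H; rewrite /simple big_seq big1// => c cA.
  by case: eqP => [E|]; rewrite ?mulr0//; exfalso; apply: H; exists c.
have walk_simple g : mwalk n (simple g) = mwalk n g.
  apply: eq_walk_count => c cn; apply: simpleE.
  have ck k : (c k < n.+1)%N by rewrite ltnS -cn (bigD1 k)//= leq_addr.
  exists [ffun k => Ordinal (ck k)].
    rewrite mem_filter mem_enum andbT -[X in _ == X]cn; apply/eqP.
    by apply: eq_bigr => k _; rewrite ffunE.
  by apply/colP => k; rewrite !mxE ffunE.
have cvP c x : ((X x == cv c)%:R : R) =
    \1_[set w | forall k, X w k 0 = ([ffun i => nat_of_ord (c i)] k)%:R] x.
  rewrite indicE; congr (nat_of_bool _)%:R; apply/eqP/idP.
    by move=> E; apply/mem_set => k /=; rewrite E !mxE ffunE.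
  by move=> /set_mem /= E; apply/colP => k; rewrite E !mxE ffunE.
have mE c : measurable [set w | forall k, X w k 0 = ([ffun i => nat_of_ord (c i)] k)%:R].
  rewrite [X in measurable X](_ : _ =
      \bigcap_(k in [set: 'I_K]) ((fun w => X w k 0) @^-1` [set (c k)%:R])).
    apply: fin_bigcap_measurable => // k _; rewrite -[X in measurable X]setTI.
    exact: mX.
  apply/seteqP; split => w /=.
    by move=> H k _ /=; rewrite H ffunE.
  by move=> H k; rewrite ffunE; exact: H.
have mind c : measurable_fun setT (fun w => (X w == cv c)%:R : R).
  rewrite (_ : (fun w => _) = \1_[set w | forall k, X w k 0 =
    ([ffun i => nat_of_ord (c i)] k)%:R]); last exact/funext/cvP.
  exact: measurable_indic.
have intind c : c \in A -> \int[P]_w (X w == cv c)%:R =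
    mwalk n (fun x => (x == cv c)%:R).
  rewrite mem_filter => /andP[/eqP cn _].
  under eq_Rintegral do rewrite cvP.
  have cn' : (\sum_k [ffun i => nat_of_ord (c i)] k)%N = n.
    by rewrite -[RHS]cn; apply: eq_bigr => k _; rewrite ffunE.
  rewrite /Rintegral integral_indic// setIT.
  apply: (etrans (congr1 fine (lawX _ cn'))).
  rewrite /= -walk_count_pmf//.
  congr walk; apply/funext => x; congr (_ == _)%:R.
  by apply/colP => k; rewrite !mxE ffunE.
have msimple g : measurable_fun setT (fun w => simple g (X w)).
  by apply: measurable_sum => c; exact: measurable_funM.
have integ (u : T -> R) M : measurable_fun setT u -> (forall w, `|u w| <= M) ->
    P.-integrable setT (EFin \o u).
  by move=> mu uM; apply: (@bounded_integrable _ _ _ _ _ M).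
have intsum g (r : seq {ffun 'I_K -> 'I_n.+1}) : {subset r <= A} ->
    \int[P]_w (\sum_(c <- r) g (cv c) * (X w == cv c)%:R) =
    mwalk n (fun x => \sum_(c <- r) g (cv c) * (x == cv c)%:R) /\
    P.-integrable setT
     (EFin \o (fun w => \sum_(c <- r) g (cv c) * (X w == cv c)%:R)).
  elim: r => [|c r IH] rA.
    under eq_Rintegral do rewrite big_nil.
    split.
      rewrite Rintegral_cst// mul0r -[LHS](walk_cst step p1 n 0); congr walk.
      by apply/funext => x; rewrite big_nil.
    rewrite (_ : (fun w => _) = fun=> 0).
      by apply: (integ _ 0) => // w; rewrite normr0.
    by apply/funext => w; rewrite big_nil.
  have [IH1 IH2] := IH (fun c' c'r => rA c' (@mem_behead _ (c :: r) c' c'r)).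
  have i1 : P.-integrable setT (EFin \o (fun w => g (cv c) * (X w == cv c)%:R)).
    apply: (integ _ `|g (cv c)|); first exact: measurable_funM.
    by move=> w; rewrite normrM ler_piMr//; case: eqP; rewrite ?normr0 ?normr1.
  have i2 : P.-integrable setT (EFin \o (fun w => ((X w == cv c)%:R : R))).
    apply: (integ _ 1) => // w.
    by case: eqP; rewrite ?normr0 ?normr1.
  under eq_Rintegral do rewrite big_cons.
  split.
    rewrite RintegralD// RintegralZl// intind ?rA ?mem_head// IH1 -walkZ -walkD.
    by congr walk; apply/funext => x; rewrite big_cons.
  rewrite (_ : (fun w => _) = fun w => g (cv c) * (X w == cv c)%:R +
     \sum_(c <- r) g (cv c) * (X w == cv c)%:R).
    exact: (integrableD measurableT i1 IH2).
  by apply/funext => w; rewrite big_cons.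
have ihX := integ _ _ mh (fun w => hB (X w)).
have [Eh ih] := intsum h A (fun c cA => cA).
have [E1 i1] := intsum (fun=> 1) A (fun c cA => cA).
rewrite -walk_simple -Eh; apply/eqP; rewrite -subr_eq0 -normr_eq0.
rewrite eq_le normr_ge0 andbT -RintegralB//.
apply: le_trans (le_normr_Rintegral _ _) _ => //; first exact: (integrableB measurableT ihX ih).
have icst := finite_measure_integrable_cst P 1 measurableT.
have id : P.-integrable setT (EFin \o (fun w => B * (1 - simple (fun=> 1) (X w)))).
  exact: (integrableZl measurableT B (integrableB measurableT icst i1)).
(* [simple (fun=> 1)] is the indicator of the count vectors, so the bound is [B] times the mass off
   them. *)
apply: (@le_trans _ _ (\int[P]_w (B * (1 - simple (fun=> 1) (X w))))).
  apply: le_Rintegral => //.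
    exact: (integrable_norm (integrableB measurableT ihX ih)).
  move=> w _ /=; have [H|H] := pselect (exists2 c, c \in A & X w = cv c).
    by rewrite -/(simple h (X w)) !simpleE// !subrr normr0 mulr0.
  by rewrite -/(simple h (X w)) !simple0// !subr0 mulr1.
rewrite RintegralZl//; last exact: (integrableB measurableT icst i1).
rewrite RintegralB// E1 -/(simple (fun=> 1)) walk_simple walk_cst//.
have PT := @probability_setT _ _ _ P.
by rewrite Rintegral_cst// mul1r (congr1 fine PT) subrr mulr0.
Qed.

End MultinomialLaw.

(** * The limiting infimum *)

(** Heine-Cantor with [y] allowed to leave the segment. *)
Lemma continuous_uniform_on_segment {R : realType} (g : R -> R) (A eps : R) :
  continuous g -> 0 < eps ->
  exists2 delta : R, 0 < delta & forall x y, `|x| <= A -> `|x - y| <= delta ->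
    `|g x - g y| <= eps.
Proof.
move=> cg eps0.
have e20 : 0 < eps / 2 by rewrite divr_gt0.
have /compact_near_coveringP nc := @segment_compact R (- A) A.
pose P (delta x : R) := forall y, `|x - y| <= delta -> `|g x - g y| <= eps.
have H : \forall delta \near (0 : R)^'+, [set` `[- A, A]] `<=` P delta.
  apply: nc => x _; have /cvgrPdist_le/(_ _ e20) := cg x.
  move=> /nbhs_normP[r /= r0 hr].
  have r20 : 0 < r / 2 by rewrite divr_gt0.
  exists ([set y | `|x - y| < r / 2], [set e | e < r / 2]) => /=.
    split; first by apply/nbhs_normP; exists (r / 2).
    exact: nbhs_right_lt.
  move=> [y e] /= [xy er] z yz.
  have h1 : `|g x - g y| <= eps / 2 by apply: hr => /=; lra.
  have h2 : `|g x - g z| <= eps / 2.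
    apply: hr => /=; have := ler_normD (x - y) (y - z).
    by rewrite addrA subrK; lra.
  have := ler_normD (g y - g x) (g x - g z).
  by rewrite addrA subrK (distrC (g y) (g x)); lra.
have [e [e0 He]] := filter_ex (filterI (nbhs_right_gt 0) H).
exists e => // x y xA; apply: He => /=.
by rewrite in_itv /= -ler_norml.
Qed.

Section LinearInfimum.
Context {R : realType} {K : nat}.

(* The infimum may be restricted to a countable subfamily that is dense in [V]. *)
Lemma measurable_linear_inf d (T : measurableType d) (Z : T -> 'cV[R]_K)
    (V : set 'cV[R]_K) : random_vector Z ->
  measurable_fun setT (fun w => ereal_inf [set (dotv v (Z w))%:E | v in V]).
Proof.
move=> mZ.
pose close (i : 'cV[rat]_K * nat) v :=
  V v /\ forall k, `|v k 0 - ratr (i.1 k 0)| <= i.2.+1%:R^-1.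
pose pick i : 'cV[R]_K := xget 0 (close i).
(* An index pairs a rational point with a precision; it selects one nearby point of [V], or
   contributes the neutral [+oo] when there is none. *)
pose u (n : nat) w : \bar R := if unpickle n is Some i then
  if `[< exists v, close i v >] then (dotv (pick i) (Z w))%:E else +oo%E
  else +oo%E.
have mu n : measurable_fun setT (u n).
  rewrite /u; case: (unpickle n) => [i|]; last exact: measurable_cst.
  case: asboolP => _; last exact: measurable_cst.
  by apply/measurable_EFinP; apply: measurable_sum => k; exact: measurable_funM.
rewrite (_ : (fun w => _) = fun w => einfs (u ^~ w) 0%N).
  exact: measurable_fun_einfs.
apply/funext => w; rewrite /einfs; apply/eqP; rewrite eq_le; apply/andP; split.
  apply: le_ereal_inf_tmp => _ [n _ <-]; rewrite /u.
  case: (unpickle n) => [i|]; rewrite ?leey//.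
  case: asboolP => [[v iv]|_]; rewrite ?leey//.
  apply: ereal_inf_lbound; exists (pick i) => //.
  by have [] := xgetPex 0 (ex_intro _ v iv).
apply: le_ereal_inf_tmp => _ [v Vv <-].
apply/lee_addgt0Pr => e e0.
pose S := 1 + \sum_k `|Z w k 0|.
have S0 : 0 < S by rewrite ltr_pwDl// sumr_ge0.
(* The factor 2 pays for two approximations through the rational point: from [v] to it and from it
   to the selected member. *)
pose m := Num.truncn (2 * S / e).
have mS : 2 * m.+1%:R^-1 * S <= e.
  rewrite mulrAC ler_pdivrMr// (mulrC e) -ler_pdivrMr//.
  exact: (ltW (truncnS_gt _)).
have [dl dlE] : exists dl : R, dl = m.+1%:R^-1 by exists m.+1%:R^-1.
have dl0 : 0 < dl by rewrite dlE invr_gt0.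
rewrite -dlE in mS.
have hq k : exists q : rat, `|v k 0 - ratr q| <= dl.
  have /rat_in_itvoo[q] : v k 0 - dl < v k 0 + dl by lra.
  rewrite in_itv /= => /andP[h1 h2]; exists q; rewrite ler_norml.
  by apply/andP; split; lra.
have [q hq'] := boolp.choice hq.
pose i := (\col_k q k : 'cV[rat]_K, m).
have iv : close i v by split => // k; rewrite mxE -dlE.
have [Vp hp] := xgetPex 0 (ex_intro _ v iv : exists v, close i v).
apply: (@le_trans _ _ (dotv (pick i) (Z w))%:E).
  apply: ereal_inf_lbound; exists (pickle i) => //; rewrite /u pickleK.
  by case: asboolP => // -[]; exists v.
rewrite -EFinD lee_fin addrC -lerBlDr -dotvBl dotvC.
apply: le_trans (ler_norm _) _.
have vp k : `|(pick i - v) k 0| <= 2 * dl.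
  rewrite !mxE; have [_ /(_ k) h1] := iv; have h2 := hp k.
  move: h1 h2; rewrite /= -/(pick i) -dlE !ler_norml => /andP[? ?] /andP[? ?].
  by apply/andP; split; lra.
apply: le_trans (dotv_bound _ vp) _; apply: le_trans mS.
by rewrite mulrC ler_wpM2l ?mulr_ge0 ?(ltW dl0)// /S lerDr.
Qed.

End LinearInfimum.

(** Where [p k 0 = 0] the variance of the coordinate is 0, so its law is the point mass at 0. *)
Lemma normal_vector_support {R : realType} {K : nat} d (T : measurableType d)
    (Q : probability T R) (p : 'cV[R]_K) (Z : T -> 'cV[R]_K) :
  normal_vector Q 0 (multinomial_cov p) Z ->
  {ae Q, forall w, forall k, p k 0 = 0 -> Z w k 0 = 0}.
Proof.
move=> [mZ law]; apply: filter_forall => k.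
have [pk|pk] := eqVneq (p k 0) 0; last first.
  by apply: aeW => w E; rewrite E eqxx in pk.
have mE : measurable [set w | Z w k 0 = 0].
  by rewrite -[X in measurable X]setTI; exact: (mZ k measurableT [set 0]).
have QE : Q [set w | Z w k 0 = 0] = 1%E.
  have := law (delta_mx k 0) [set 0] (measurable_set1 _).
  have -> : dotv (delta_mx k 0) (multinomial_cov p *m delta_mx k 0) = 0.
    rewrite dotvC dotv_delta mxE (bigD1 k)//= !mxE !eqxx pk !mul0r add0r.
    by rewrite big1// => i ik; rewrite !mxE (negbTE ik) mulr0.
  rewrite /normal_law eqxx dotvC dotv0l diracE mem_set//= => <-.
  by congr (Q _); apply/seteqP; split => w /=; rewrite dotvC dotv_delta.
exists (~` [set w | Z w k 0 = 0]); split; first exact: measurableC.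
  by rewrite probability_setC// QE subee.
by move=> w /=; apply: contra_not => E _.
Qed.

(** * Convergence in distribution *)

(** When the frequencies are within [delta] of [p], homogeneity of [phi] makes the two integrands
    equal. Elsewhere they differ by at most [2 * B], and Chebyshev's inequality bounds the weight of
    these positions. *)
Lemma eq_walk_local {R : realType} {K : nat} (p : 'cV[R]_K) (phi u : 'cV[R]_K -> R)
    (g : R -> R) (B delta : R) (n : nat) : simplex p -> (0 < n)%N -> 0 < delta ->
  (forall x, `|g x| <= B) -> (forall a (z : 'cV[R]_K), 0 <= a -> phi (a *: z) = a * phi z) ->
  (forall x : 'cV[R]_K, (forall k, 0 <= x k 0) ->
     (forall k, `|x k 0 - p k 0| <= delta) -> u x = phi (x - p)) ->
  `|walk (fun k => p k 0) (fun k => delta_mx k 0) n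
      (fun c => g (Num.sqrt n%:R * u (n%:R^-1 *: c)))
    - walk (fun k => p k 0) (fun k => delta_mx k 0) n
      (g \o phi \o normalized_count p n)|
  <= 2 * B * K%:R / delta ^+ 2 * n%:R^-1.
Proof.
move=> hp n0 d0 gB phiZ uphi.
pose mwalk := walk (fun k => p k 0) (fun k => delta_mx k 0 : 'cV[R]_K) n.
have [p0 p1] : (forall k, 0 <= p k 0) /\ \sum_k p k 0 = 1.
  by case: hp => ? <-; split => //; apply: eq_bigr => k _; rewrite mxE mul1r.
have n0R : 0 < n%:R :> R by rewrite ltr0n.
have sn0 : 0 < Num.sqrt n%:R :> R by rewrite sqrtr_gt0.
have B0 : 0 <= B by apply: le_trans (gB 0).
have scale (c : 'cV[R]_K) : n%:R^-1 *: c - p =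
    (Num.sqrt n%:R)^-1 *: normalized_count p n c.
  rewrite /normalized_count scalerA -invfM -expr2 sqr_sqrtr ?(ltW n0R)//.
  by rewrite scalerBr scalerA mulVf ?scale1r// gt_eqF.
pose h c := g (Num.sqrt n%:R * u (n%:R^-1 *: c)) - g (phi (normalized_count p n c)).
pose nonneg (c : 'cV[R]_K) := [forall k, 0 <= c k 0].
rewrite -walkB.
(* The hypothesis on [u] covers only the orthant, so the difference is cut off outside it before
   pointwise estimates. *)
rewrite (@eq_walk_count _ _ _ _ _ (fun c => if nonneg c then h c else 0)); last first.
  move=> c _; rewrite (_ : nonneg _)//; apply/forallP => k.
  by rewrite mxE ler0n.
apply: le_trans (le_walk_norm _ p0 _ _) _.
apply: (@le_trans _ _ (mwalk (fun c => \sum_k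
   2 * B / delta ^+ 2 * n%:R^-1 * normalized_count p n c k 0 ^+ 2))).
  apply: le_walk => // c.
  have pos k : 0 <= 2 * B / delta ^+ 2 * n%:R^-1 * normalized_count p n c k 0 ^+ 2.
    by rewrite mulr_ge0 ?sqr_ge0// mulr_ge0 ?invr_ge0 ?(ltW n0R)// divr_ge0 ?sqr_ge0 ?mulr_ge0.
  case: ifPn => [/forallP c0|_]; last by rewrite normr0; apply: sumr_ge0 => k _.
  have devE k : (n%:R^-1 *: c) k 0 - p k 0 =
      (Num.sqrt n%:R)^-1 * normalized_count p n c k 0.
    by have /colP/(_ k) := scale c; rewrite !mxE.
  have [/existsP[k kd]|/existsPn near] :=
      boolP [exists k, delta < `|(n%:R^-1 *: c) k 0 - p k 0|]; last first.
    rewrite /h uphi; last first.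
    - by move=> k; rewrite leNgt; exact: near.
    - by move=> k; rewrite mxE mulr_ge0 ?invr_ge0 ?(ltW n0R).
    rewrite scale phiZ ?invr_ge0 ?(ltW sn0)// mulVKf ?gt_eqF// subrr normr0.
    by apply: sumr_ge0.
  apply: (@le_trans _ _ (2 * B)).
    apply: le_trans (ler_normB _ _) _; rewrite mulrDl mul1r.
    by apply: lerD; exact: gB.
  rewrite (bigD1 k)//=; apply: ler_wpDr; first exact: sumr_ge0.
  have -> : 2 * B / delta ^+ 2 * n%:R^-1 * normalized_count p n c k 0 ^+ 2 =
     2 * B * (((n%:R^-1 *: c) k 0 - p k 0) ^+ 2 / delta ^+ 2).
    by rewrite devE exprMn exprVn sqr_sqrtr ?(ltW n0R)//; ring.
  apply: ler_peMr; first exact: mulr_ge0.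
  rewrite ler_pdivlMr ?exprn_gt0// mul1r -[leRHS]real_normK ?num_real//.
  by rewrite lerXn2r ?nnegrE ?(ltW d0) ?(ltW kd).
rewrite /mwalk walk_sum.
apply: (@le_trans _ _ (\sum_(k < K) 2 * B / delta ^+ 2 * n%:R^-1)).
  apply: ler_sum => k _; rewrite walkZ ler_piMr ?walk_normalized_sqr//.
  by rewrite mulr_ge0 ?invr_ge0 ?(ltW n0R)// divr_ge0 ?sqr_ge0 ?mulr_ge0.
rewrite sumr_const card_ord -mulr_natl le_eqVlt; apply/orP; left; apply/eqP.
by ring.
Qed.

Section Assembly.
Context {R : realType} {K : nat}.

(** The law of [Z] is used at [- a], which has the same variance as [a]. *)
Lemma normal_vector_opp_cos d (T : measurableType d) (Q : probability T R)
    (p : 'cV[R]_K) (Z : T -> 'cV[R]_K) : simplex p ->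
  normal_vector Q 0 (multinomial_cov p) Z -> forall a b,
  \int[Q]_w cos (dotv a (- Z w) + b) =
    expR (- (dotv a (multinomial_cov p *m a) / 2)) * cos b.
Proof.
move=> hp [mZ law] a b.
have v0 : 0 <= dotv a (multinomial_cov p *m a).
  rewrite (multinomial_cov_variance hp); apply: sumr_ge0 => k _.
  by rewrite mulr_ge0 ?sqr_ge0//; case: hp.
have mX : measurable_fun setT (fun w => dotv (- a) (Z w)).
  by apply: measurable_sum => k; exact: measurable_funM.
rewrite /Rintegral (eq_integral (fun w => (cos (dotv (- a) (Z w) + b))%:E)).
  rewrite (integral_normal_law_cos _ v0 mX)// => A mA.
  rewrite (law (- a) A mA) (dotvC _ 0) dotv0l mulmxN dotvNl dotvNr opprK.
  by [].
by move=> w _; rewrite dotvNl dotvNr.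
Qed.

Lemma bounded_funE (g : R -> R) : bounded_fun g ->
  exists B, forall x, `|g x| <= B.
Proof.
move=> [M [_ HM]]; exists (M + 1) => x.
by apply: HM => //; rewrite ltrDl.
Qed.

Lemma loc_unif_continuous_comp (g : R -> R) (phi : 'cV[R]_K -> R) (L : R) :
  continuous g -> 0 <= L -> phi 0 = 0 ->
  (forall (x y : 'cV[R]_K) (r : R), (forall k, `|x k 0 - y k 0| <= r) ->
     `|phi x - phi y| <= L * r) ->
  loc_unif_continuous (g \o phi).
Proof.
move=> cg L0 phi0 phiL M eps eps0.
have [delta d0 hd] := continuous_uniform_on_segment (L * M) cg eps0.
exists (delta / (L + 1)) => [|x y xM xy]; first by rewrite divr_gt0// ltr_wpDl.
apply: hd => /=.
  rewrite -[phi x]subr0 -phi0; apply: phiL => k.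
  by rewrite mxE subr0.
apply: le_trans (phiL _ _ _ xy) _.
rewrite mulrA ler_pdivrMr ?ltr_wpDl// mulrC ler_wpM2l ?(ltW d0)//.
by rewrite lerDl.
Qed.

End Assembly.

Unset Implicit Arguments.

Theorem theorem3p1 (R : realType) (K : nat) (hK : (1 <= K)%N)
    (fstar : 'cV[R]_K) (hfstar : simplex fstar)
    (d : nat -> measure_display) (T : forall n, measurableType (d n))
    (P : forall n, probability (T n) R) (f : forall n, T n -> 'cV[R]_K)
    (hf : forall n, multinomial_law (P n) n fstar (fun w => n%:R *: f n w))
    (hfmeas : forall n, random_vector (f n))
    (l : 'cV[R]_K) (hl : forall k, 0 <= l k 0)
    (eps : R) (heps : 0 <= eps)
    (C : 'M[R]_K) (hC : forall i j, 0 <= C i j) (hC0 : forall k, C k k = 0)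
    (D : 'M[R]_K) (hD : forall i j, D i j = 0 \/ D i j = 1)
    (hD0 : forall k, D k k = 0)
    (d' : measure_display) (T' : measurableType d') (Q : probability T' R)
    (Z : T' -> 'cV[R]_K)
    (hZ : normal_vector Q 0 (multinomial_cov fstar) Z) :
  cvg_in_distribution P
    (fun n w => Num.sqrt n%:R *
       (audit_value l eps C D (f n w) - audit_value l eps C D fstar))
    Q
    (fun w => ereal_inf [set (dotv (t.2 + l) (Z w))%:E
                        | t in dual_argmax l eps C D fstar]).
Proof.
pose psi := audit_value l eps C D.
have fs0 k : 0 <= fstar k 0 by case: hfstar.
have [mZ _] := hZ.
have [phi [[delta delta0 local] phiZ [L L0 phiL] mphi phiE]] :=
  audit_value_derivative hl heps hC0 hD hD0 fs0.
set W := fun w => ereal_inf _.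
have WE : {ae Q, forall w, W w = (phi (- Z w))%:E}.
  apply: filterS (normal_vector_support hZ) => w Zw.
  by apply: phiE => k; exact: Zw.
have mpsi n : measurable_fun setT (fun w => psi (f n w)).
  exact: (audit_value_measurable hl heps hC0 hD hD0 (hfmeas n)).
have mX n : measurable_fun setT (fun w =>
    Num.sqrt n%:R * (psi (f n w) - psi fstar)).
  by apply: measurable_funM => //; exact: measurable_funB.
have mW : measurable_fun setT W.
  rewrite (_ : W = fun w => ereal_inf [set (dotv v (Z w))%:E |
      v in [set t.2 + l | t in dual_argmax l eps C D fstar]]).
    exact: measurable_linear_inf.
  by apply/funext => w; rewrite image_comp.
split => //; first by apply: filterS WE => w ->.
move=> g cg /bounded_funE[B gB].
pose h := g \o phi.
have mNZ : random_vector (fun w => - Z w).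
  by move=> k; rewrite (_ : (fun w => _) = fun w => - Z w k 0);
    [exact: measurableT_comp|apply/funext => w; rewrite mxE].
have mg : measurable_fun setT g by exact: continuous_measurable_fun.
have mhZ : measurable_fun setT (h \o (fun w => - Z w)).
  by apply: measurableT_comp => //; exact: mphi.
have phi0 : phi 0 = 0 by rewrite -(scale0r (0 : 'cV[R]_K)) phiZ ?mul0r.
have hc : loc_unif_continuous h by exact: loc_unif_continuous_comp cg L0 phi0 phiL.
have clt := multinomial_clt hfstar mNZ (normal_vector_opp_cos hfstar hZ) hK
  (fun x => gB (phi x)) hc mhZ.
have EW : ('E_Q[g \o (fine \o W)] = (\int[Q]_w h (- Z w))%:E)%E.
  rewrite unlock /Rintegral fineK; last first.
    apply: integrable_fin_num => //; apply: (@bounded_integrable _ _ _ _ _ B) => //.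
    by move=> w; exact: gB.
  apply: ae_eq_integral => //.
  - apply/measurable_EFinP; apply: measurableT_comp => //.
    exact: measurableT_comp.
  - exact/measurable_EFinP.
  - by apply: filterS WE => w E _ /=; rewrite E.
(* For [n = 0] the counts [n%:R *: f n w] do not determine [f n w]; the limit needs the formula only
   eventually. *)
have EX n : (0 < n)%N ->
    ('E_(P n)[g \o (fun w => Num.sqrt n%:R * (psi (f n w) - psi fstar))%R] =
    (walk (fun k => fstar k 0) (fun k => delta_mx k 0) n
      (fun c => g (Num.sqrt n%:R * (psi (n%:R^-1 *: c) - psi fstar))))%:E)%E.
  move=> n0.
  pose G (c : 'cV[R]_K) := g (Num.sqrt n%:R * (psi (n%:R^-1 *: c) - psi fstar)).
  have nK w : n%:R^-1 *: (n%:R *: f n w) = f n w.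
    by rewrite scalerA mulVf ?scale1r// pnatr_eq0 -lt0n.
  have mG : measurable_fun setT (G \o (fun w => n%:R *: f n w)).
    rewrite (_ : _ \o _ = g \o (fun w => Num.sqrt n%:R * (psi (f n w) - psi fstar))).
      exact: measurableT_comp.
    by apply/funext => w; rewrite /G /= nK.
  rewrite -(multinomial_law_expectation hfstar (hf n) mG (fun c => gB _)).
  rewrite unlock /Rintegral fineK.
    by apply: eq_integral => w _; rewrite /G /= nK.
  apply: integrable_fin_num => //; apply: (@bounded_integrable _ _ _ _ _ B) => //.
  by move=> w; exact: gB.
rewrite EW; apply: cvg_EFin.
  by near=> n; rewrite EX//; near: n; exact: nbhs_infty_gt.
pose u n := walk (fun k => fstar k 0) (fun k => delta_mx k 0) n
  (fun c => g (Num.sqrt n%:R * (psi (n%:R^-1 *: c) - psi fstar))).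
pose v n := walk (fun k => fstar k 0) (fun k => delta_mx k 0) n
  (h \o normalized_count fstar n).
have uv : u n - v n @[n --> \oo] --> (0 : R).
  apply: (@cvg_dist_le _ _ (fun n => 2 * B * K%:R / delta ^+ 2 * n%:R^-1)).
    near=> n; rewrite subr0.
    apply: (@eq_walk_local _ _ fstar phi (fun x => psi x - psi fstar) g B delta) => //.
    by near: n; exact: nbhs_infty_gt.
  rewrite -[X in _ --> X](mulr0 (2 * B * K%:R / delta ^+ 2)); apply: cvgMr.
  apply/gtr0_cvgV0; last exact: cvgr_idn.
  by near=> n; rewrite ltr0n; near: n; exact: nbhs_infty_gt.
have cu : u n @[n --> \oo] --> \int[Q]_w h (- Z w).
  rewrite (_ : u = fun n => (u n - v n) + v n); last first.
    by apply/funext => n; rewrite subrK.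
  by rewrite -[X in _ --> X]add0r; apply: cvgD => //; exact: clt.
apply: cvg_trans cu; apply: near_eq_cvg; near=> n => /=.
by rewrite EX//; near: n; exact: nbhs_infty_gt.
Unshelve. all: by end_near. Qed.
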